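(* Suppose that $(\iota,\Psi,F_t)$ is a formal ternary law over a graded $\mathbb Z[1/2]$-algebra $R$, and set $\mu:=\mathbb G(\iota,\Psi,F_t)$. Then $\mathbb T(\mu)=(\iota,\Psi,F_t)$.
   Context: Graded rings are commutative; formal group laws $\mu(x,y)$ over graded rings are homogeneous with $|x|=|y|=-2$. Over a graded $\mathbb Z[1/2]$-algebra $R$: Framed involution. A framed involution $(\iota,\Psi)$ over $R$ is a power series $\Psi(t)=t+O(t^2)\in R[[t]]$, $|t|=-2$, homogeneous of degree $-2$, with $\iota(t):=t-2\Psi(t)$ satisfying $\iota(\iota(t))=t$. (Over general graded rings one imposes a ''$2$-saturated'' version of this equation and of the axioms below; over $\mathbb Z[1/2]$-algebras this is the same.) Series. An $(m,n)$-series over $R$ is an element $G_t=1+\sum_{l=1}^mG_l(x_1,\dots,x_n)t^l$ of $R[[x_1,\dots,x_n]][t]$ homogeneous of degree $0$, where $|x_i|=-2$, $|t|=2$. When $G_t(0,\dots,0)=1$, write $G_t=\prod_i(1+r_it)$ in a splitting algebra. Substitution is rootwise: $F_t(G_t,u,v):=\prod_iF_t(r_i,u,v)$. For $\Phi(x)=x+O(x^2)$ homogeneous of degree $-2$, the transport is $(\Phi_*G)_t=\prod_i\bigl(1+\Phi(r_i(\Phi^{-1}(x_1),\dots,\Phi^{-1}(x_n)))t\bigr)$. Formal ternary law. A formal ternary law (FTL) over $R$ with framed involution $(\iota,\Psi)$ is a $(4,3)$-series $F_t(x,y,z)=1+\sum_{l=1}^4F_lt^l$ over $R$ such that: (1)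 $F_t(x,0,0)=(1+xt)^2(1+\iota(x)t)^2$; (2) $F_t$ is symmetric in $x,y,z$; (3) $F_t(F_t(x,y,z),u,v)=F_t(x,F_t(y,z,u),v)$; (4) $\widehat F_t:=\Psi_*F_t$ satisfies $\widehat F_t(-x,y,z)=\widehat F_{-t}(x,y,z)$; (5) $F_t(x,x,y)=(1+yt)^2(1+S(x,y)t+P(x,y)t^2)$ for some $S,P\in R[[x,y]]$. $\mathbb T$. For a formal group law $\mu$ with formal inverse $\iota$ (write $x^{1}=x$, $x^{-1}=\iota(x)$), $\mathbb T(\mu)=(\iota,\Psi,F_t)$ with $\Psi(x)=(x-\iota(x))/2$ and $F_t(x,y,z)=\prod_{\varepsilon_i\in\{\pm1\},\,\varepsilon_1\varepsilon_2\varepsilon_3=-1}(1+\mu(\mu(x^{\varepsilon_1},y^{\varepsilon_2}),z^{\varepsilon_3})t)$; it is an FTL. $\mathbb G$. For an FTL $(\iota,\Psi,F_t)$: $S=F_1(x,x,y)-2y$ and $P=F_2(x,x,y)-2yS-y^2$. The series $D:=S^2-4P$ is divisible by $x^2$ and $\equiv16x^2$ mod $(x,y)^3$, so it has a unique square root $\sqrt D=4x\sqrt{D/(16x^2)}\equiv4x$ mod $(x,y)^2$ (binomial series). Put $B(x,y):=\tfrac12(S-\sqrt D)$; $f(x,y):=B(\iota(x),\iota(y))$; $[2](x):=f(x,0)\equiv2x$ mod $x^2$; $[1/2](x)$ is the compositional inverse of $[2](x)$. Then $\mathbb G(\iota,\Psi,F_t)$ is the formal group law $f([1/2](x),y)$.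 *)

(* Defs.v *)
From HB Require Import structures.
From mathcomp Require Import all_boot all_order all_algebra all_fingroup.
From mathcomp Require Import mpoly.
From mathcomp Require Import boolp classical_sets.

Set Implicit Arguments.
Unset Strict Implicit.
Unset Printing Implicit Defensive.

Import GRing.Theory.
Local Open Scope ring_scope.

(* Z-grading of a commutative ring: every element is a finite sum of
   homogeneous elements, in a unique way. *)
Record grading (R : comNzRingType) := Grading {
  hpart :> int -> R -> Prop;
  hpart0 : forall d, hpart d 0;
  hpartB : forall d a b, hpart d a -> hpart d b -> hpart d (a - b);
  hpart1 : hpart 0 1;
  hpartM : forall d e a b, hpart d a -> hpart e b -> hpart (d + e) (a * b);
  hpart_span : forall a : R, exists (s : seq int) (c : int -> R),
    [/\ uniq s, forall d, hpart d (c d) & a = \sum_(d <- s) c d];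
  hpart_free : forall (s : seq int) (c : int -> R),
    uniq s -> (forall d, hpart d (c d)) -> \sum_(d <- s) c d = 0 ->
    forall d, d \in s -> c d = 0
}.

(* R[[x_0, ..., x_(n-1)]], as families of coefficients indexed by monomials. *)
Record mps (R : comNzRingType) (n : nat) := MPS { mpscoef :> 'X_{1..n} -> R }.

Section SeriesRing.
Context (R : comNzRingType) (n : nat).
Implicit Types f g h : mps R n.

HB.instance Definition _ := gen_eqMixin (mps R n).
HB.instance Definition _ := gen_choiceMixin (mps R n).

Lemma mpsP f g : (forall m, f m = g m) -> f = g.
Proof. by case: f g => [f] [g] /= /funext ->. Qed.

Definition mps0 : mps R n := MPS (fun=> 0).
Definition mpsN f : mps R n := MPS (fun m => - f m).
Definition mpsD f g : mps R n := MPS (fun m => f m + g m).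
Definition mps1 : mps R n := MPS (fun m => (m == 0%MM)%:R).
Definition mpsM f g : mps R n := MPS (fun m =>
  \sum_(k : 'X_{1..n < (mdeg m).+1, (mdeg m).+1} | m == (k.1 + k.2)%MM)
     f k.1 * g k.2).

Fact mpsDA : associative mpsD.
Proof. by move=> f g h; apply: mpsP => m /=; rewrite addrA. Qed.
Fact mpsDC : commutative mpsD.
Proof. by move=> f g; apply: mpsP => m /=; rewrite addrC. Qed.
Fact mps0D : left_id mps0 mpsD.
Proof. by move=> f; apply: mpsP => m /=; rewrite add0r. Qed.
Fact mpsND : left_inverse mps0 mpsN mpsD.
Proof. by move=> f; apply: mpsP => m /=; rewrite addNr. Qed.

HB.instance Definition _ :=
  GRing.isZmodule.Build (mps R n) mpsDA mpsDC mps0D mpsND.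

Definition mpstrunc (b : nat) f : {mpoly R[n]} :=
  \sum_(a : 'X_{1..n < b}) f a *: 'X_[a].

Lemma mcoeff_mpstrunc b f m : (mdeg m < b)%N -> (mpstrunc b f)@_m = f m.
Proof.
move=> lt_mb; rewrite /mpstrunc raddf_sum /= (bigD1 (BMultinom lt_mb)) //=.
rewrite mcoeffZ mcoeffX eqxx mulr1 big1 ?addr0 // => a ne_am.
rewrite mcoeffZ mcoeffX; case: eqP => [eq_am|_]; last by rewrite mulr0.
by case/eqP: ne_am; apply: val_inj.
Qed.

Lemma mpsM_trunc b f g m :
  (mdeg m < b)%N -> mpsM f g m = (mpstrunc b f * mpstrunc b g)@_m.
Proof.
move=> lt_mb; rewrite mcoeffM /=; apply: eq_bigr => -[k1 k2] _ /=.
by rewrite !mcoeff_mpstrunc // (leq_trans (bmdeg _)).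
Qed.

Fact mpsMC : commutative mpsM.
Proof.
move=> f g; apply: mpsP => m.
by rewrite !(@mpsM_trunc (mdeg m).+1) // mulrC.
Qed.

Fact mpsMA : associative mpsM.
Proof.
move=> f g h; apply: mpsP => m; pose b := (mdeg m).+1.
transitivity (mpstrunc b f * (mpstrunc b g * mpstrunc b h))@_m.
- rewrite mcoeffM; apply: eq_bigr => -[k1 k2] _.
  by rewrite (@mpsM_trunc b g h) ?mcoeff_mpstrunc ?bmdeg.
- rewrite mulrA mcoeffM; apply: eq_bigr => -[k1 k2] _.
  by rewrite (@mpsM_trunc b f g) ?mcoeff_mpstrunc ?bmdeg.
Qed.

Fact mps1M : left_id mps1 mpsM.
Proof.
move=> f; apply: mpsP => m; rewrite (@mpsM_trunc (mdeg m).+1) //.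
suff -> : mpstrunc (mdeg m).+1 mps1 = 1 by rewrite mul1r mcoeff_mpstrunc.
have lt0 : (mdeg (0%MM : 'X_{1..n}) < (mdeg m).+1)%N by rewrite mdeg0.
rewrite /mpstrunc (bigD1 (BMultinom lt0)) //= eqxx scale1r mpolyX0.
rewrite big1 ?addr0 // => a ne_a0; case: eqP => [a0|_]; last by rewrite scale0r.
by case/eqP: ne_a0; apply: val_inj.
Qed.

Fact mpsMDl : left_distributive mpsM mpsD.
Proof.
move=> f g h; apply: mpsP => m /=; rewrite -big_split /=.
by apply: eq_bigr => k _; rewrite mulrDl.
Qed.

Fact mps1_neq0 : mps1 != 0 :> mps R n.
Proof.
apply/eqP => /(congr1 (fun f : mps R n => f 0%MM)) /= /eqP.
by rewrite eqxx oner_eq0.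
Qed.

HB.instance Definition _ := GRing.Zmodule_isComNzRing.Build (mps R n)
  mpsMA mpsMC mps1M mpsMDl mps1_neq0.

End SeriesRing.

Section SeriesOps.
Context (R : comNzRingType).

Definition mpsC n (c : R) : mps R n := MPS (fun m => c *+ (m == 0%MM)).
Definition mpsX n (i : 'I_n) : mps R n := MPS (fun m => (m == U_(i)%MM)%:R).

(* f(g_0, ..., g_(n-1)), meaningful when all the g_i have zero constant term:
   monomials a with |a| > |m| then do not contribute to the coefficient of m. *)
Definition mpssubst n k (f : mps R n) (g : n.-tuple (mps R k)) : mps R k :=
  MPS (fun m => \sum_(a : 'X_{1..n < (mdeg m).+1})
                   f a * (\prod_(i < n) tnth g i ^+ a i) m).

(* f and g are congruent modulo the d-th power of the ideal of the variables. *)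
Definition mpseqmod n (d : nat) (f g : mps R n) :=
  forall m, (mdeg m < d)%N -> f m = g m.

(* f is homogeneous of degree d, each variable having degree -2. *)
Definition mpshomog (gr : grading R) n (d : int) (f : mps R n) :=
  forall m, gr (d + 2 * (mdeg m)%:Z) (f m).

Definition subst1 k (f : mps R 1) (a : mps R k) := mpssubst f [tuple a].
Definition subst2 k (f : mps R 2) (a b : mps R k) := mpssubst f [tuple a; b].

(* Unique when f = u x + O(x^2) with u invertible. *)
Definition compinv (f : mps R 1) : mps R 1 :=
  xget 0 [set h : mps R 1 | h 0%MM = 0 /\ subst1 f h = mpsX ord0].

End SeriesOps.

Section SeriesInT.
Context (R : comNzRingType).

(* Elements of R[[x_0, ..., x_(n-1)]][t] are polynomials in t with coefficients
   in the power series ring; t has degree 2. *)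
Definition is_series (gr : grading R) (m n : nat) (G : {poly mps R n}) :=
  [/\ (size G <= m.+1)%N, G`_0 = 1 &
      forall l, mpshomog gr (- 2 * l%:Z) G`_l].

Definition tsubst n k (G : {poly mps R n}) (g : n.-tuple (mps R k)) :
  {poly mps R k} := map_poly (fun f => mpssubst f g) G.

Definition tsubst3 k (F : {poly mps R 3}) (a b c : mps R k) : {poly mps R k} :=
  tsubst F [tuple a; b; c].

(* 1 + r t *)
Definition tlin n (r : mps R n) : {poly mps R n} := 1 + r *: 'X.

(* Splitting algebra of G = 1 + G_1 t + ... + G_m t^m over A = R[[x]], where
   the G_l have zero constant term. It is A[r_0, ..., r_(m-1)] modulo the
   coefficients of \prod_i (1 + r_i t) - G, which is finite free over A; the r_i
   being topologically nilpotent, it is also the quotient of the power series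
   ring R[[x, r]] by the ideal generated by the same elements. The latter
   presentation is used, so that power series can be evaluated at the r_i. *)
Definition splbase k m (f : mps R k) : mps R (k + m) :=
  mpssubst f [tuple mpsX R (lshift m i) | i < k].

Definition splroot k m (i : 'I_m) : mps R (k + m) := mpsX R (rshift k i).

Definition splrel k m (G : {poly mps R k}) : {poly mps R (k + m)} :=
  \prod_(i < m) tlin (splroot k i) - map_poly (@splbase k m) G.

Definition spleq k m (G : {poly mps R k}) (a b : mps R (k + m)) :=
  exists c : 'I_m.+1 -> mps R (k + m),
    a - b = \sum_(l < m.+1) c l * (splrel m G)`_l.

(* H = \prod_i Phi(r_i) in the splitting algebra of G, with
   \prod_i (1 + r_i t) = G. Since A embeds in the splitting algebra, and
   symmetric expressions in the roots come from A, such an H in A[t] exists and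
   is unique. *)
Definition rootwise k m (G : {poly mps R k})
    (Phi : mps R (k + m) -> {poly mps R (k + m)}) (H : {poly mps R k}) :=
  forall j, spleq G (\prod_(i < m) Phi (splroot k i))`_j (splbase m H`_j).

(* H = Phi_* G, for an (m, n)-series G with G(0, ..., 0) = 1. *)
Definition is_transport m n (Phi : mps R 1) (G H : {poly mps R n}) :=
  rootwise (m := m)
    (tsubst G [tuple subst1 (compinv Phi) (mpsX R i) | i < n])
    (fun r => tlin (subst1 Phi r)) H.

End SeriesInT.

Section Laws.
Context (R : comNzRingType) (gr : grading R) (half : R).

Definition is_framed_involution (iota Psi : mps R 1) :=
  [/\ mpseqmod 2 Psi (mpsX R ord0), mpshomog gr (- 2) Psi,
      iota = mpsX R ord0 - 2 * Psi & subst1 iota iota = mpsX R ord0].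

Record ternary := Ternary {
  tiota : mps R 1;
  tPsi : mps R 1;
  tF : {poly mps R 3}
}.

Definition is_FTL (T : ternary) : Prop :=
  let iota := tiota T in let Psi := tPsi T in let F := tF T in
  is_framed_involution iota Psi /\
  is_series gr 4 F /\
  [/\ (let x := mpsX R (ord0 : 'I_1) in
       tsubst3 F x 0 0 = tlin x ^+ 2 * tlin (subst1 iota x) ^+ 2),
      (forall s : {perm 'I_3}, tsubst F [tuple mpsX R (s i) | i < 3] = F),
      (let x := mpsX R (inord 0 : 'I_5) in
       let y := mpsX R (inord 1 : 'I_5) in
       let z := mpsX R (inord 2 : 'I_5) in
       let u := mpsX R (inord 3 : 'I_5) in
       let v := mpsX R (inord 4 : 'I_5) in
       exists H : {poly mps R 5},
         rootwise (m := 4) (tsubst3 F x y z)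
           (fun r => tsubst3 F r (splbase 4 u) (splbase 4 v)) H /\
         rootwise (m := 4) (tsubst3 F y z u)
           (fun r => tsubst3 F (splbase 4 x) r (splbase 4 v)) H),
      (let x := mpsX R (inord 0 : 'I_3) in
       let y := mpsX R (inord 1 : 'I_3) in
       let z := mpsX R (inord 2 : 'I_3) in
       exists Fhat : {poly mps R 3},
         is_transport 4 Psi F Fhat /\
         tsubst3 Fhat (- x) y z = Fhat \Po (- 'X)) &
      (let x := mpsX R (inord 0 : 'I_2) in
       let y := mpsX R (inord 1 : 'I_2) in
       exists S P : mps R 2,
         tsubst3 F x x y = tlin y ^+ 2 * (1 + S *: 'X + P *: 'X^2))].

Definition is_FGL (mu : mps R 2) :=
  let x := mpsX R (ord0 : 'I_1) in
  let x2 := mpsX R (inord 0 : 'I_2) in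
  let y2 := mpsX R (inord 1 : 'I_2) in
  let x3 := mpsX R (inord 0 : 'I_3) in
  let y3 := mpsX R (inord 1 : 'I_3) in
  let z3 := mpsX R (inord 2 : 'I_3) in
  [/\ mpshomog gr (- 2) mu,
      subst2 mu x 0 = x,
      subst2 mu x2 y2 = subst2 mu y2 x2 &
      subst2 mu (subst2 mu x3 y3) z3 = subst2 mu x3 (subst2 mu y3 z3)].

(* The formal inverse of a formal group law; it exists and is unique. *)
Definition FGLinv (mu : mps R 2) : mps R 1 :=
  xget 0 [set i : mps R 1 | i 0%MM = 0 /\ subst2 mu (mpsX R ord0) i = 0].

(* x^e, with e = true standing for the sign -1; a product of signs is -1 when
   the exclusive disjunction of the booleans is true. *)
Definition FGLsign k (mu : mps R 2) (e : bool) (a : mps R k) : mps R k :=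
  if e then subst1 (FGLinv mu) a else a.

Definition TT (mu : mps R 2) : ternary :=
  let t := mpsX R (ord0 : 'I_1) in
  let x := mpsX R (inord 0 : 'I_3) in
  let y := mpsX R (inord 1 : 'I_3) in
  let z := mpsX R (inord 2 : 'I_3) in
  Ternary (FGLinv mu) (mpsC 1 half * (t - FGLinv mu))
    (\prod_(e : bool * bool * bool | e.1.1 (+) e.1.2 (+) e.2)
       tlin (subst2 mu (subst2 mu (FGLsign mu e.1.1 x) (FGLsign mu e.1.2 y))
                       (FGLsign mu e.2 z))).

Definition GG (T : ternary) : mps R 2 :=
  let iota := tiota T in
  let x := mpsX R (inord 0 : 'I_2) in
  let y := mpsX R (inord 1 : 'I_2) in
  let Fxxy := tsubst3 (tF T) x x y in
  let S := Fxxy`_1 - 2 * y in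
  let P := Fxxy`_2 - 2 * y * S - y ^+ 2 in
  let D := S ^+ 2 - 4 * P in
  let sqrtD := xget 0 [set E : mps R 2 | E ^+ 2 = D /\ mpseqmod 2 E (4 * x)] in
  let B := mpsC 2 half * (S - sqrtD) in
  let f := subst2 B (subst1 iota x) (subst1 iota y) in
  let two := subst2 f (mpsX R (ord0 : 'I_1)) 0 in
  subst2 f (subst1 (compinv two) x) y.

End Laws.

(* Main.v *)
(* A power series whose lowest term along one axis has an invertible coefficient
   is a nonzerodivisor. So if two products of factors 1 + r t agree and all but
   one of the differences r - r' are of this kind, then r = r' for the remaining
   one: over an arbitrary Z[1/2]-algebra the roots are matched by their linear
   parts, and no splitting algebra is needed, because axioms (3) and (4) are only
   evaluated where the inner quadruples split, the root variables being sent to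
   actual power series.
   Write F(x, y, z) for the quadruple of roots, i for the involution and
   F(x, x, y) = {y, y, A, B}. Axiom (3) at (x, 0, 0, u, v) gives
   F(i x, u, v) = F(x, i u, v), whence D = 16 x^2 + ..., A(i x, y) = B(x, y), and
   axiom (4) gives A(x, i y) = i B(x, y). With 2 y = f(y, 0), axiom (3) at
   (0, y, y, u, v) reads
     F(2 y, u, v) F(i 2 y, u, v) = F(0, A(y, u), v) F(0, B(y, u), v).
   At v = 0 this determines F(x, y, 0), whose symmetry makes mu commutative; for
   general v the right-hand side is then known, and four of its eight linear
   factors are forced to be those of F(2 y, u, v). The symmetry of F(x, y, z)
   finally gives the associativity of mu. *)
Require Import Defs.
From HB Require Import structures.
From mathcomp Require Import all_boot all_order all_algebra all_fingroup.
From mathcomp Require Import ssrcomplements mpoly.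
From mathcomp Require Import boolp classical_sets.
From mathcomp Require Import ring zify.

Set Implicit Arguments.
Unset Strict Implicit.
Unset Printing Implicit Defensive.

Import GRing.Theory.
Local Open Scope ring_scope.

(** * The ring of power series and substitution *)

(** The four roots of F(x, y, z) must have linear parts x + y - z, x - y + z, - x + y + z and - x -
    y - z, those of F(i x, y, z) the negatives of these. Among the eight known linear factors of the
    product, a candidate r is a root of F(x, y, z) as soon as the monic polynomial of F(i x, y, z)
    takes a nonzerodivisor value at r. That quadruple has not been split at this stage, and the
    coordinate axes give no information: there it becomes t, t, i t, i t, while r restricts to t or
    i t, so the value is 0. The value is therefore measured on the curves (t, t, t) and (t, t, i t),
    on which symmetry, the identity F(i x, u, v) = F(x, i u, v) and axiom (5) do split the
    quadruple. Neither curve serves all four candidates: - x - y - z on the first and x + y - z on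
    the second yield the lowest coefficient 48, and 3 need not be invertible. With the right curve
    for each candidate the coefficient is - 16. *)

Section Coefficients.
Context (R : comNzRingType) (n : nat).
Implicit Types f g : mps R n.

Lemma mps_coefD f g m : (f + g) m = f m + g m.
Proof. by []. Qed.

Lemma mps_coefN f m : (- f) m = - f m.
Proof. by []. Qed.

Lemma mps_coef_sum I (r : seq I) (P : pred I) (F : I -> mps R n) m :
  (\sum_(i <- r | P i) F i) m = \sum_(i <- r | P i) F i m.
Proof. by elim/big_rec2: _ => // i y f _ <-. Qed.

Lemma mps_coef0M f g : (f * g) 0%MM = f 0%MM * g 0%MM.
Proof.
have lt0 : (mdeg (0%MM : 'X_{1..n}) < 1)%N by rewrite mdeg0.
by rewrite [LHS](mpsM_trunc _ _ lt0) rmorphM /= !mcoeff_mpstrunc.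
Qed.

Lemma mpsC_coefM c f m : (mpsC n c * f) m = c * f m.
Proof.
rewrite [LHS](mpsM_trunc _ _ (ltnSn _)).
suff -> : mpstrunc (mdeg m).+1 (mpsC n c) = c%:MP.
  by rewrite mcoeffCM mcoeff_mpstrunc.
have lt0 : (mdeg (0%MM : 'X_{1..n}) < (mdeg m).+1)%N by rewrite mdeg0.
rewrite /mpstrunc (bigD1 (BMultinom lt0)) //= eqxx mpolyX0.
rewrite big1 ?addr0 => [|a ne_a0]; first by rewrite alg_mpolyC.
case: eqP => [a0|_]; last by rewrite scale0r.
by case/eqP: ne_a0; apply: val_inj.
Qed.

Lemma mpsC_coef0 (c : R) : mpsC n c 0%MM = c.
Proof. by rewrite /= eqxx. Qed.

Lemma mpsC_is_zmod : zmod_morphism (@mpsC R n).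
Proof. by move=> a b; apply: mpsP => m; rewrite /= mulrnBl. Qed.

Lemma mpsC_is_monoid : monoid_morphism (@mpsC R n).
Proof.
split=> [|a b]; apply: mpsP => m //.
by rewrite mpsC_coefM /= mulrnAr.
Qed.

HB.instance Definition _ := GRing.isZmodMorphism.Build R (mps R n) (@mpsC R n)
  mpsC_is_zmod.
HB.instance Definition _ := GRing.isMonoidMorphism.Build R (mps R n) (@mpsC R n)
  mpsC_is_monoid.

Definition mpsord b f := forall m, (mdeg m < b)%N -> f m = 0.

Lemma mpsord_le a b f : (a <= b)%N -> mpsord b f -> mpsord a f.
Proof. by move=> le_ab fb m /leq_trans/(_ le_ab)/fb. Qed.

Lemma mpsordD b f g : mpsord b f -> mpsord b g -> mpsord b (f + g).
Proof. by move=> fb gb m lt_mb; rewrite mps_coefD fb // gb // addr0. Qed.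

Lemma mpsordN b f : mpsord b f -> mpsord b (- f).
Proof. by move=> fb m lt_mb; rewrite mps_coefN fb // oppr0. Qed.

Lemma mpsordB b f g : mpsord b f -> mpsord b g -> mpsord b (f - g).
Proof. by move=> fb gb; apply/mpsordD/mpsordN. Qed.

Lemma mpsordM a b f g : mpsord a f -> mpsord b g -> mpsord (a + b) (f * g).
Proof.
move=> fa gb m lt_mab; rewrite [LHS]/= /mpsM /= big1 // => -[k1 k2] /= /eqP eq_m.
have [lt_k1|le_k1] := ltnP (mdeg k1) a; first by rewrite fa ?mul0r.
rewrite gb ?mulr0 // -(ltn_add2l a) (leq_ltn_trans _ lt_mab) //.
by rewrite [X in (_ <= mdeg X)%N]eq_m mdegD leq_add2r.
Qed.

Lemma mpsordMl b f g : mpsord b g -> mpsord b (f * g).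
Proof. by move=> gb; rewrite -[b]add0n; apply: mpsordM. Qed.

Lemma mpsordMr b f g : mpsord b f -> mpsord b (f * g).
Proof. by move=> fb; rewrite mulrC; apply: mpsordMl. Qed.

Lemma mpsord1P f : f 0%MM = 0 <-> mpsord 1 f.
Proof.
split=> [f0 m|]; last by apply; rewrite mdeg0.
by rewrite ltnS leqn0 mdeg_eq0 => /eqP ->.
Qed.

Lemma mpsordX a f : f 0%MM = 0 -> mpsord a (f ^+ a).
Proof.
move=> /mpsord1P f0; elim: a => [|a IHa]; first by move=> m; rewrite ltn0.
by rewrite exprS -add1n; apply: mpsordM.
Qed.

Lemma mpsord_all0 f : (forall b, mpsord b f) -> f = 0.
Proof. by move=> fb; apply: mpsP => m; apply: (fb (mdeg m).+1). Qed.

End Coefficients.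

Section Substitution.
Context (R : comNzRingType).

Definition point n k (g : n.-tuple (mps R k)) := forall i, tnth g i 0%MM = 0.

Lemma mpsX_coef0 n (i : 'I_n) : mpsX R i 0%MM = 0.
Proof. by rewrite /= eq_sym mnm1_eq0. Qed.

Section Fixed.
Context (n k : nat) (g : n.-tuple (mps R k)).

Local Notation ev := (mmap (@mpsC R k) (tnth g)).
Local Notation subst f := (mpssubst f g).

Lemma mpsord_mmap1 a : point g -> mpsord (mdeg a) (mmap1 (tnth g) a).
Proof.
move=> g0; rewrite mdegE /mmap1; elim/big_ind2: _ => [m|i f j h|i _] //.
  exact: mpsordM.
exact: mpsordX.
Qed.

(** A coefficient of the result depends on finitely many coefficients of [f], so it can be read off
    a polynomial evaluation, whose morphism laws are available. The bound [b] is free so that one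
    truncation serves all coefficients of smaller degree. *)
Lemma mpssubst_trunc b f m : point g -> (mdeg m < b)%N ->
  subst f m = ev (mpstrunc b f) m.
Proof.
move=> g0 lt_mb; rewrite /mpstrunc raddf_sum /= mps_coef_sum.
under [RHS]eq_bigr => a _ do rewrite mmapZ mmapX mpsC_coefM.
rewrite [RHS](bigID (fun a : 'X_{1..n < b} => mdeg a < (mdeg m).+1)%N) /=.
(* The substituted series have no constant term, so a monomial [a] of degree above [mdeg m] is sent
   to a series of order above [mdeg m]. *)
rewrite [X in _ + X]big1 ?addr0 => [|a]; last first.
  by rewrite -leqNgt => lt_ma; rewrite mpsord_mmap1 ?mulr0.
pose I : subFinType _ := 'X_{1..n < (mdeg m).+1}.
pose J : subFinType _ := 'X_{1..n < b}.
rewrite (big_sub_widen I J predT (fun a => f a * mmap1 (tnth g) a m)) //.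
by move=> x /leq_trans; apply.
Qed.

Lemma mpsord_ev b c f : point g -> mpsord b f -> mpsord b (ev (mpstrunc c f)).
Proof.
move=> g0 fb m lt_mb; rewrite /mpstrunc raddf_sum /= mps_coef_sum big1 // => a _.
rewrite mmapZ mmapX mpsC_coefM.
have [lt_a|le_a] := ltnP (mdeg a) b; first by rewrite fb // mul0r.
by rewrite mpsord_mmap1 ?mulr0 // (leq_trans lt_mb).
Qed.

Lemma mpssubst_ord b f : point g -> mpsord b f -> mpsord b (subst f).
Proof.
move=> g0 fb m lt_mb.
by rewrite (mpssubst_trunc _ g0 (ltnSn _)) (mpsord_ev _ g0 fb).
Qed.

Lemma mpssubstD f h : subst (f + h) = subst f + subst h.
Proof.
apply: mpsP => m; rewrite mps_coefD /= -big_split /=.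
by apply: eq_bigr => a _; rewrite mulrDl.
Qed.

Lemma mpssubstN f : subst (- f) = - subst f.
Proof.
apply: mpsP => m; rewrite mps_coefN /= -sumrN.
by apply: eq_bigr => a _; rewrite mulNr.
Qed.

Lemma mpssubstC c : point g -> subst (mpsC n c) = mpsC k c.
Proof.
move=> g0; apply: mpsP => m; rewrite [LHS]/=.
have lt0 : (mdeg (0%MM : 'X_{1..n}) < (mdeg m).+1)%N by rewrite mdeg0.
rewrite (bigD1 (BMultinom lt0)) //= eqxx big1 => [|i _]; last by rewrite mnm0E.
rewrite mulr1n mulr_natr big1 => [|a ne_a0]; first by rewrite addr0.
case: eqP => [a0|_]; last by rewrite mul0r.
by case/eqP: ne_a0; apply: val_inj.
Qed.

(** The truncation of a product and the product of the truncations agree below degree [b]; their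
    difference evaluates to a series of order at least [b], which the coefficient at [m] does not
    see. *)
Lemma mpssubstM f h : point g -> subst (f * h) = subst f * subst h.
Proof.
move=> g0; apply: mpsP => m; set b := (mdeg m).+1.
have coef_ev p : (mdeg p < b)%N -> forall q, subst q p = ev (mpstrunc b q) p.
  by move=> lt_pb q; apply: mpssubst_trunc.
transitivity ((ev (mpstrunc b f) * ev (mpstrunc b h)) m); last first.
  apply: eq_bigr => -[p1 p2] _ /=; rewrite -!coef_ev ?bmdeg //.
rewrite coef_ev // -rmorphM /=; apply/eqP; rewrite -subr_eq0; apply/eqP.
rewrite -mps_coefN -mps_coefD -raddfB /=.
set p := (_ - _); have: forall a, (mdeg a < b)%N -> p@_a = 0.
  move=> a lt_ab; rewrite mcoeffB mcoeff_mpstrunc // [X in X - _](mpsM_trunc _ _ lt_ab).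
  by rewrite subrr.
move=> p0; rewrite [in LHS]/mmap mps_coef_sum big1_seq // => a _.
rewrite mpsC_coefM; have [lt_a|le_a] := ltnP (mdeg a) b.
  by rewrite p0 // mul0r.
by rewrite mpsord_mmap1 ?mulr0.
Qed.

End Fixed.

Section Morphism.
Context (n k : nat) (g : n.-tuple (mps R k)) (g0 : point g).

Fact mpssubst_is_zmod : zmod_morphism (fun f => mpssubst f g).
Proof. by move=> f h; rewrite mpssubstD mpssubstN. Qed.

Fact mpssubst_is_monoid : monoid_morphism (fun f => mpssubst f g).
Proof.
split=> [|f h]; last exact: mpssubstM.
by rewrite -(rmorph1 (@mpsC R n)) mpssubstC // rmorph1.
Qed.

(** The proof of [point g] is an argument of the function, so that the morphism structure, valid
    only for such [g], can be inferred from the term. *)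
Definition substmor (_ : point g) (f : mps R n) := mpssubst f g.

HB.instance Definition _ := GRing.isZmodMorphism.Build _ _ (substmor g0)
  mpssubst_is_zmod.
HB.instance Definition _ := GRing.isMonoidMorphism.Build _ _ (substmor g0)
  mpssubst_is_monoid.

Lemma substmorE f : substmor g0 f = mpssubst f g.
Proof. by []. Qed.

Lemma mpssubstB f h : mpssubst (f - h) g = mpssubst f g - mpssubst h g.
Proof. exact: (rmorphB (substmor g0)). Qed.

Lemma mpssubst0 : mpssubst 0 g = 0.
Proof. exact: (rmorph0 (substmor g0)). Qed.

Lemma mpssubst1 : mpssubst 1 g = 1.
Proof. exact: (rmorph1 (substmor g0)). Qed.

Lemma mpssubst_nat a : mpssubst a%:R g = a%:R.
Proof. exact: (rmorph_nat (substmor g0)). Qed.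

Lemma mpssubst_exp f a : mpssubst (f ^+ a) g = mpssubst f g ^+ a.
Proof. exact: (rmorphXn (substmor g0)). Qed.

Lemma mpssubst_sum I (r : seq I) (P : pred I) (F : I -> mps R n) :
  mpssubst (\sum_(i <- r | P i) F i) g = \sum_(i <- r | P i) mpssubst (F i) g.
Proof. exact: (rmorph_sum (substmor g0)). Qed.

Lemma mpssubstX i : mpssubst (mpsX R i) g = tnth g i.
Proof.
apply: mpsP => m; pose b := (mdeg m).+2.
rewrite (mpssubst_trunc (b := b)) ?leqnSn //.
have lt1 : (mdeg (U_(i)%MM : 'X_{1..n}) < b)%N by rewrite mdeg1.
rewrite /mpstrunc (bigD1 (BMultinom lt1)) //= eqxx scale1r big1 => [|a ne_ai].
  by rewrite addr0 mmapX mmap1U.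
case: eqP => [ai|_]; last by rewrite scale0r.
by case/eqP: ne_ai; apply: val_inj.
Qed.

End Morphism.

Section Polynomial.
Context (n : nat).

Definition mpspoly (p : {mpoly R[n]}) : mps R n := MPS (fun m => p@_m).

Fact mpspoly_is_zmod : zmod_morphism mpspoly.
Proof. by move=> p q; apply: mpsP => m; rewrite /= mcoeffB. Qed.

Fact mpspoly_is_monoid : monoid_morphism mpspoly.
Proof.
split=> [|p q]; apply: mpsP => m; first by rewrite /= mcoeff1.
by rewrite /= mcoeffM.
Qed.

HB.instance Definition _ := GRing.isZmodMorphism.Build _ _ mpspoly
  mpspoly_is_zmod.
HB.instance Definition _ := GRing.isMonoidMorphism.Build _ _ mpspoly
  mpspoly_is_monoid.

Lemma mpspolyX a : mpspoly 'X_[a] = mmap1 (@mpsX R n) a.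
Proof.
rewrite -(mmap1_id R a) rmorph_prod; apply: eq_bigr => i _.
by rewrite rmorphXn; congr (_ ^+ _); apply: mpsP => m; rewrite /= mcoeffX eq_sym.
Qed.

Lemma mpspolyC c : mpspoly c%:MP = mpsC n c.
Proof. by apply: mpsP => m; rewrite /= mcoeffC eq_sym mulr_natr. Qed.

Lemma mpspoly_trunc b f : mpsord b (f - mpspoly (mpstrunc b f)).
Proof.
by move=> m lt_mb; rewrite mps_coefD mps_coefN /= mcoeff_mpstrunc // subrr.
Qed.

(** Density of polynomials: the morphisms agree on every truncation of [f], and preservation of the
    order makes the images of the remainder arbitrarily small. *)
Lemma mpsmor_eq k (phi psi : {rmorphism mps R n -> mps R k}) :
    (forall b f, mpsord b f -> mpsord b (phi f)) ->
    (forall b f, mpsord b f -> mpsord b (psi f)) ->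
    (forall c, phi (mpsC n c) = psi (mpsC n c)) ->
    (forall i, phi (mpsX R i) = psi (mpsX R i)) ->
  forall f, phi f = psi f.
Proof.
move=> phi_ord psi_ord eqC eqX f; apply/eqP; rewrite -subr_eq0; apply/eqP.
apply: mpsord_all0 => b; set p := mpspoly (mpstrunc b f).
have eq_p : phi p = psi p.
  rewrite /p /mpstrunc !rmorph_sum; apply: eq_bigr => a _ /=.
  rewrite -mul_mpolyC !rmorphM /= mpspolyC eqC mpspolyX; congr (_ * _).
  by rewrite !rmorph_prod; apply: eq_bigr => i _; rewrite !rmorphXn /= eqX.
have q_ord := @mpspoly_trunc b f; rewrite -/p in q_ord.
have -> : phi f - psi f = phi (f - p) - psi (f - p).
  by rewrite !rmorphB /= eq_p opprB addrA subrK.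
by apply: mpsordB; [apply: phi_ord | apply: psi_ord].
Qed.

End Polynomial.

Lemma point_subst n k l (g : n.-tuple (mps R k)) (h : k.-tuple (mps R l)) :
  point g -> point h -> point [tuple mpssubst (tnth g i) h | i < n].
Proof.
move=> g0 h0 i; rewrite tnth_mktuple; apply/mpsord1P/mpssubst_ord => //.
by apply/mpsord1P.
Qed.

Lemma mpssubst_comp n k l (f : mps R n) (g : n.-tuple (mps R k))
    (h : k.-tuple (mps R l)) : point g -> point h ->
  mpssubst (mpssubst f g) h = mpssubst f [tuple mpssubst (tnth g i) h | i < n].
Proof.
move=> g0 h0; have gh0 := point_subst g0 h0.
apply: (mpsmor_eq (phi := substmor h0 \o substmor g0) (psi := substmor gh0))
    => [b f' fb|b f' fb|c|i].
- by do 2!apply: mpssubst_ord => //.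
- exact: mpssubst_ord.
- by rewrite /= !substmorE !mpssubstC.
- by rewrite /= !substmorE !mpssubstX // tnth_mktuple.
Qed.

Lemma mpssubst_id n (f : mps R n) : mpssubst f [tuple mpsX R i | i < n] = f.
Proof.
have X0 : point [tuple mpsX R i | i < n].
  by move=> i; rewrite tnth_mktuple mpsX_coef0.
apply: (mpsmor_eq (phi := substmor X0) (psi := idfun)) => // [b f' fb|c|i].
- exact: mpssubst_ord.
- exact: mpssubstC.
- by rewrite /= substmorE mpssubstX // tnth_mktuple.
Qed.

Lemma mpssubst_coef0 n k (f : mps R n) (g : n.-tuple (mps R k)) :
  point g -> mpssubst f g 0%MM = f 0%MM.
Proof.
move=> g0; have f0 : mpsord 1 (f - mpsC n (f 0%MM)).
  by apply/mpsord1P; rewrite mps_coefD mps_coefN /= eqxx subrr.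
have /mpsord1P/eqP := mpssubst_ord g0 f0.
rewrite mpssubstD mpssubstN mpssubstC // mps_coefD mps_coefN [in X in _ - X]/=.
by rewrite eqxx subr_eq0 => /eqP.
Qed.

End Substitution.

Arguments substmor : simpl never.
Arguments mpssubst : simpl never.
Arguments subst1 : simpl never.
Arguments subst2 : simpl never.

(** * Leading terms and nonzerodivisors *)

Section LeadingTerms.
Context (R : comNzRingType).

Lemma mps_coefM_single n (f g : mps R n) a m :
    (forall k1 k2, (k1 + k2 = a + m)%MM -> k1 != a -> f k1 * g k2 = 0) ->
  (f * g) (a + m)%MM = f a * g m.
Proof.
move=> fg0; rewrite [LHS]/= /mpsM /=.
have lt_a : (mdeg a < (mdeg (a + m)%MM).+1)%N by rewrite mdegD ltnS leq_addr.
have lt_m : (mdeg m < (mdeg (a + m)%MM).+1)%N by rewrite mdegD ltnS leq_addl.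
rewrite (bigD1 (BMultinom lt_a, BMultinom lt_m)) //= big1 ?addr0 //.
case=> k1 k2 /andP[/eqP eq_k ne_k]; apply: fg0 => //=.
apply: contraNneq ne_k => eq_k1; apply/eqP; congr (_, _); apply: val_inj => //=.
by move/eqP: eq_k; rewrite /= eq_k1 eqm_add2l => /eqP.
Qed.

Lemma mpsX_coef1 n (i j : 'I_n) : mpsX R i U_(j)%MM = (j == i)%:R.
Proof.
congr (nat_of_bool _)%:R; apply/eqP/eqP => [/mnmP/(_ i)|-> //].
by rewrite !mnm1E eqxx; case: eqP.
Qed.

Lemma mps_coef1M n (f g : mps R n) i :
  (f * g) U_(i)%MM = f 0%MM * g U_(i)%MM + f U_(i)%MM * g 0%MM.
Proof.
pose f0 := mpsC n (f 0%MM); pose g0 := mpsC n (g 0%MM).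
have -> : f * g = (f - f0) * (g - g0) + f0 * g + (g0 * f - g0 * f0) by ring.
have ord2 : mpsord 2 ((f - f0) * (g - g0)).
  apply: (@mpsordM _ _ 1 1); apply/mpsord1P; rewrite mps_coefD mps_coefN /=;
  by rewrite eqxx subrr.
rewrite !mps_coefD mps_coefN !mpsC_coefM ord2 ?mdeg1 // add0r; congr (_ + _).
by rewrite /= mnm1_eq0 mulr0n mulr0 subr0 mulrC.
Qed.

Lemma mpsord2P n (f : mps R n) :
  mpsord 2 f <-> f 0%MM = 0 /\ forall i, f U_(i)%MM = 0.
Proof.
split=> [f2|[f0 f1] m]; first by split=> [|i]; rewrite f2 ?mdeg0 ?mdeg1.
rewrite ltnS leq_eqVlt ltnS leqn0 mdeg_eq0.
by case/orP => [/mdeg1P[i /eqP ->]|/eqP ->].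
Qed.

(** Chain rule at the origin: the part of [f] of order 2 stays of order 2 after substitution, so
    only the constant and linear terms matter. *)
Lemma mpssubst_coef1 n k (f : mps R n) (g : n.-tuple (mps R k)) i :
  point g -> mpssubst f g U_(i)%MM = \sum_j f U_(j)%MM * tnth g j U_(i)%MM.
Proof.
move=> g0; pose f1 := \sum_j mpsC n (f U_(j)%MM) * mpsX R j.
have f1U j : f1 U_(j)%MM = f U_(j)%MM.
  rewrite mps_coef_sum; under eq_bigr do rewrite mpsC_coefM mpsX_coef1.
  rewrite (bigD1 j) //= eqxx mulr1 big1 ?addr0 // => l /negbTE ne_lj.
  by rewrite eq_sym ne_lj mulr0.
have f10 : f1 0%MM = 0.
  by rewrite mps_coef_sum big1 // => j _; rewrite mpsC_coefM mpsX_coef0 mulr0.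
pose f0 := mpsC n (f 0%MM).
have ord2 : mpsord 2 (f - (f0 + f1)).
  apply/mpsord2P; split=> [|j]; rewrite mps_coefD mps_coefN mps_coefD.
    by rewrite f10 /= eqxx mulr1n addr0 subrr.
  by rewrite f1U /= mnm1_eq0 add0r subrr.
have /(_ U_(i)%MM) := mpssubst_ord g0 ord2; rewrite mdeg1 => /(_ isT)/eqP.
rewrite mpssubstD mpssubstN mpssubstD mps_coefD mps_coefN subr_eq0 => /eqP ->.
rewrite mps_coefD mpssubstC // [X in X + _]/= mnm1_eq0 add0r.
rewrite mpssubst_sum // mps_coef_sum; apply: eq_bigr => j _.
by rewrite mpssubstM // mpssubstC // mpssubstX // mpsC_coefM.
Qed.

(* Setting to zero the variables other than the i-th turns f into
   c X_i ^ d + O(X_i ^ (d + 1)). *)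
Definition axis_lead n (i : 'I_n) d (c : R) (f : mps R n) :=
  (forall j, (j < d)%N -> f (U_(i) *+ j)%MM = 0) /\ f (U_(i) *+ d)%MM = c.

Lemma axis_lead1 n (i : 'I_n) (f : mps R n) :
  f 0%MM = 0 -> axis_lead i 1 (f U_(i)%MM) f.
Proof. by move=> f0; split=> [[]|] //; rewrite mulm0n. Qed.

Lemma axis_leadM n (i : 'I_n) d e a b (f g : mps R n) :
  axis_lead i d a f -> axis_lead i e b g -> axis_lead i (d + e) (a * b) (f * g).
Proof.
move=> [f0 <-] [g0 <-].
have eq_c k1 k2 c : (k1 + k2 = U_(i) *+ c)%MM ->
    [/\ k1 = (U_(i) *+ k1 i)%MM, k2 = (U_(i) *+ k2 i)%MM & c = (k1 i + k2 i)%N].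
  move=> /mnmP eq_k; split=> [||]; last first.
  - by have := eq_k i; rewrite mnmDE mulmnE mnm1E eqxx mul1n.
  - apply/mnmP=> j; have := eq_k j; rewrite mnmDE !mulmnE mnm1E.
    case: eqP => [<-|_]; first by rewrite !mul1n.
    by rewrite !mul0n => /eqP; rewrite addn_eq0 => /andP[_ /eqP].
  - apply/mnmP=> j; have := eq_k j; rewrite mnmDE !mulmnE mnm1E.
    case: eqP => [<-|_]; first by rewrite !mul1n.
    by rewrite !mul0n => /eqP; rewrite addn_eq0 => /andP[/eqP].
split=> [j lt_j|]; last first.
  have mulmnDr : (U_(i) *+ (d + e) = U_(i) *+ d + U_(i) *+ e)%MM.
    by apply/mnmP=> j; rewrite !(mnmDE, mulmnE) mulnDr.
  rewrite mulmnDr; apply: mps_coefM_single => k1 k2.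
  rewrite -mulmnDr => /eq_c[k1E k2E eq_de].
  have [lt_k1|lt_k1|eq_k1] := ltngtP (k1 i) d; last by rewrite {1}k1E eq_k1 eqxx.
    by rewrite k1E f0 ?mul0r.
  by rewrite k2E g0 ?mulr0 //; lia.
rewrite [LHS]/= /mpsM /= big1 // => -[k1 k2] /= /eqP/esym/eq_c[k1E k2E eq_j].
have [lt_k1|le_k1] := ltnP (bmnm k1 i) d; first by rewrite k1E f0 ?mul0r.
by rewrite k2E g0 ?mulr0 //; lia.
Qed.

(** Lexicographic induction on the degree [e] off the axis, then on the exponent [t] along it. In
    the coefficient of [f * g] at [U_(i) *+ d + m], a monomial of [f] off the axis meets a
    coefficient of [g] with smaller [e], a higher power of the axis variable meets one with smaller
    [t], and lower powers are absent from [f]. Off the axis [f] may well have terms of degree below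
    [d]. *)
Lemma axis_lead_reg n (i : 'I_n) d c v (f g : mps R n) :
  axis_lead i d c f -> v * c = 1 -> f * g = 0 -> g = 0.
Proof.
move=> [f0 fd] vc fg0.
suff g0 e t m : mdeg m = (e + t)%N -> m i = t -> g m = 0.
  apply: mpsP => m; apply: (g0 (mdeg m - m i)%N (m i)) => //.
  by rewrite subnK // mdegE (bigD1 i) //= leq_addr.
elim/ltn_ind: e t m => e IHe; elim/ltn_ind => t IHt m deg_m m_i.
have := @mps_coefM_single _ f g (U_(i) *+ d)%MM m; rewrite fg0 fd.
move=> single; suff: c * g m = 0.
  by move=> cg0; rewrite -[g m]mul1r -vc -mulrA cg0 mulr0.
rewrite -single // => {single} k1 k2 eq_k ne_k1.
have deg_k : (mdeg k1 + mdeg k2 = d + (e + t))%N.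
  by rewrite -mdegD eq_k mdegD mdegMn mdeg1 mul1n deg_m.
have k_i : (k1 i + k2 i = d + t)%N.
  by rewrite -mnmDE eq_k mnmDE mulmnE mnm1E eqxx mul1n m_i.
have le_i (k : 'X_{1..n}) : (k i <= mdeg k)%N.
  by rewrite mdegE (bigD1 i) //= leq_addr.
have [k1E|ne_k1E] := eqVneq k1 (U_(i) *+ k1 i)%MM; last first.
  have lt_k1 : (k1 i < mdeg k1)%N.
    rewrite ltn_neqAle le_i andbT; apply: contraNneq ne_k1E => eq_k1.
    apply/eqP/mnmP => j; rewrite mulmnE mnm1E.
    case: eqP => [<-|/eqP ne_ij]; first by rewrite mul1n.
    move/eqP: eq_k1; rewrite mdegE (bigD1 i) //= -{1}[k1 i]addn0 eqn_add2l.
    rewrite eq_sym sum_nat_eq0 => /forallP/(_ j)/implyP k1j.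
    by rewrite mul0n; apply/eqP/k1j; rewrite eq_sym.
  rewrite (IHe (mdeg k2 - k2 i)%N _ (k2 i)) ?mulr0 ?subnK ?le_i //.
  by have := le_i k2; lia.
have [lt_k1|lt_k1|eq_k1] := ltngtP (k1 i) d.
- by rewrite k1E f0 ?mul0r.
- rewrite (IHt (k2 i)) ?mulr0 //; first by lia.
  have : mdeg k1 = k1 i by rewrite {1}k1E mdegMn mdeg1 mul1n.
  lia.
by rewrite k1E eq_k1 eqxx in ne_k1.
Qed.

Lemma mps_reg1 n (i : 'I_n) c v (f g : mps R n) :
  f 0%MM = 0 -> f U_(i)%MM = c -> v * c = 1 -> f * g = 0 -> g = 0.
Proof. by move=> /(axis_lead1 i) f0 <-; apply: (axis_lead_reg f0). Qed.

Lemma mpsX_reg n (i : 'I_n) (g : mps R n) : mpsX R i * g = 0 -> g = 0.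
Proof. by apply: (@mps_reg1 _ i 1 1); rewrite ?mpsX_coef0 ?mulr1 //= eqxx. Qed.

Section Restriction.
Context (n : nat) (P : pred 'I_n).

Definition restr_tuple := [tuple if P i then mpsX R i else 0 | i < n].

Lemma point_restr : point restr_tuple.
Proof. by move=> i; rewrite tnth_mktuple; case: ifP => // _; apply: mpsX_coef0. Qed.

Lemma mpssubst_restr (f : mps R n) m :
  mpssubst f restr_tuple m = f m *+ [forall i, (m i != 0%N) ==> P i].
Proof.
have mono (a : 'X_{1..n}) : (\prod_i tnth restr_tuple i ^+ a i) m =
    (m == a)%:R *+ [forall i, (m i != 0%N) ==> P i].
  case: (boolP [forall i, (a i != 0%N) ==> P i]) => [/forallP Pa|].
    transitivity (mpspoly ('X_[a] : {mpoly R[n]}) m).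
      rewrite mpspolyX; congr (mpscoef _ _); apply: eq_bigr => i _.
      rewrite tnth_mktuple; case: ifP => // Pi.
      by have := Pa i; rewrite Pi implybF negbK => /eqP ->.
    rewrite /= mcoeffX eq_sym; case: eqP => [->|_]; last by rewrite mul0rn.
    by rewrite (introT forallP Pa).
  rewrite negb_forall => /existsP[i]; rewrite negb_imply => /andP[a_i nPi].
  have -> : \prod_i tnth restr_tuple i ^+ a i = 0.
    by rewrite (bigD1 i) //= tnth_mktuple (negbTE nPi) expr0n (negbTE a_i) mul0r.
  case: eqP => [->|_]; last by rewrite mul0rn.
  case: forallP => // /(_ i).
  by rewrite (negbTE nPi) a_i.
rewrite /=; under eq_bigr => a _ do rewrite mono.
rewrite (bigD1 (BMultinom (ltnSn (mdeg m)))) //= eqxx mulrnAr mulr1.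
rewrite big1 ?addr0 // => a ne_am; case: eqP => [ma|_]; last by rewrite mul0rn mulr0.
by case/eqP: ne_am; apply: val_inj.
Qed.

End Restriction.

Lemma mps_divX n (i : 'I_n) (f : mps R n) :
  mpssubst f (restr_tuple (predC1 i)) = 0 -> exists g, f = mpsX R i * g.
Proof.
move=> f0; exists (MPS (fun m => f (U_(i) + m)%MM)); apply: mpsP => m.
have [mi0|mi] := eqVneq (m i) 0%N.
  have := congr1 (fun h : mps R n => h m) f0; rewrite mpssubst_restr.
  case: forallP => [_|[]]; last first.
    by move=> j; apply/implyP; apply: contra_neqN => /eqP ->.
  rewrite mulr1n => ->.
  rewrite [RHS]/= /mpsM big1 // => -[k1 k2] /= /eqP mk.
  case: eqP => [k1i|_]; last by rewrite mul0r.
  by have := congr1 (fun k : 'X_{1..n} => k i) mk; rewrite mi0 mnmDE k1i mnm1E eqxx.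
have -> : m = (U_(i) + (m - U_(i)))%MM.
  by rewrite addmC submK //; apply/mnm_lepP => j; rewrite mnm1E; case: eqP => // <-;
    rewrite lt0n.
rewrite mps_coefM_single /= ?eqxx ?mul1r // => k1 k2 _ /negbTE ->.
by rewrite mul0r.
Qed.

End LeadingTerms.

(** * Products of linear factors *)

Section Reversal.
Context (R : comNzRingType) (n : nat).
Local Notation A := (mps R n).
Implicit Types (G H K : {poly A}) (r : A) (s : seq A).

Definition mps_regular (f : A) := forall g, f * g = 0 -> g = 0.

Lemma mps_regularM (f g : A) :
  mps_regular f -> mps_regular g -> mps_regular (f * g).
Proof. by move=> f_reg g_reg h; rewrite -mulrA => /f_reg/g_reg. Qed.

Lemma coef0_tlin r : (tlin r)`_0 = 1.
Proof. by rewrite coefD coef1 coefZ coefX mulr0 addr0. Qed.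

Lemma size_tlin r : (size (tlin r) <= 2)%N.
Proof.
rewrite (leq_trans (size_polyD _ _)) // geq_max size_poly1 /=.
by rewrite (leq_trans (size_scale_leq _ _)) ?size_polyX.
Qed.

Lemma coef0_tlin_prod s : (\prod_(r <- s) tlin r)`_0 = 1.
Proof.
elim: s => [|r s IHs]; first by rewrite big_nil coef1.
by rewrite big_cons coef0M coef0_tlin IHs mulr1.
Qed.

Lemma size_tlin_prod s : (size (\prod_(r <- s) tlin r)%R <= (size s).+1)%N.
Proof.
elim: s => [|r s IHs]; first by rewrite big_nil size_poly1.
rewrite big_cons (leq_trans (size_polyMleq _ _)) //= -ltnS.
by have := leq_add (@size_tlin r) IHs; case: (_ + _)%N => // m; lia.
Qed.

Lemma poly_coef0_reg K G : K`_0 = 1 -> K * G = 0 -> G = 0.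
Proof.
move=> K0 KG0; apply/polyP; elim/ltn_ind => i IHi; rewrite coef0.
have : (K * G)`_i = 0 by rewrite KG0 coef0.
rewrite coefM big_ord_recl K0 mul1r subn0 big1 ?addr0 // => j _.
by rewrite IHi ?coef0 ?mulr0 //= /bump; have := ltn_ord j; lia.
Qed.

Lemma poly_coef0_mulI K G H : K`_0 = 1 -> K * G = K * H -> G = H.
Proof.
move=> K0 /eqP; rewrite -subr_eq0 -mulrBr => /eqP/(poly_coef0_reg K0)/eqP.
by rewrite subr_eq0 => /eqP.
Qed.

(** The sum [G + H] has constant coefficient 2; scaled by [half] it can be cancelled from (G + H)(G
    - H) = 0. *)
Lemma poly_sqr_inj (half : R) G H : 2 * half = 1 -> G`_0 = 1 -> H`_0 = 1 ->
  G ^+ 2 = H ^+ 2 -> G = H.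
Proof.
move=> half2 G0 H0 /eqP; rewrite -subr_eq0 subr_sqr mulrC => /eqP GH0.
apply/eqP; rewrite -subr_eq0; apply/eqP.
have half2n : 2 * mpsC n half = 1 by rewrite -(rmorph_nat (@mpsC R n) 2) -rmorphM
  half2 rmorph1.
apply: (@poly_coef0_reg (mpsC n half *: (G + H))).
  by rewrite coefZ coefD G0 H0 mulrC -[1 + 1]/2.
by rewrite -scalerAl GH0 scaler0.
Qed.

(* For G = \prod_(i < d) (1 + r_i t) this is \prod_(i < d) (X - r_i). *)
Definition revpoly d G := \sum_(i < d.+1) ((- 1) ^+ i * G`_i) *: 'X^(d - i).

Lemma revpolyD d : {morph revpoly d : G H / G + H}.
Proof.
move=> G H; rewrite -big_split /=; apply: eq_bigr => i _.
by rewrite coefD mulrDr scalerDl.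
Qed.

Lemma revpoly0 d : revpoly d 0 = 0.
Proof. by rewrite /revpoly big1 // => i _; rewrite coef0 mulr0 scale0r. Qed.

Lemma revpolyZ d a G : revpoly d (a *: G) = a *: revpoly d G.
Proof.
rewrite /revpoly scaler_sumr; apply: eq_bigr => i _.
by rewrite coefZ mulrCA scalerA.
Qed.

Lemma revpoly_sum d I (s : seq I) (F : I -> {poly A}) :
  revpoly d (\sum_(i <- s) F i) = \sum_(i <- s) revpoly d (F i).
Proof. exact: (big_morph _ (revpolyD d) (revpoly0 d)). Qed.

Lemma revpolyXn d i : (i <= d)%N -> revpoly d 'X^i = (- 1) ^+ i *: 'X^(d - i).
Proof.
rewrite -ltnS => lt_i; rewrite /revpoly (bigD1 (Ordinal lt_i)) //=.
rewrite coefXn eqxx mulr1 big1 ?addr0 // => j ne_ji.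
by rewrite coefXn [_ == _](negbTE ne_ji) mulr0 scale0r.
Qed.

Lemma revpolyM d e G H : (size G <= d.+1)%N -> (size H <= e.+1)%N ->
  revpoly (d + e) (G * H) = revpoly d G * revpoly e H.
Proof.
move=> sG sH.
have polyE d' (P : {poly A}) : (size P <= d'.+1)%N ->
    P = \sum_(i < d'.+1) P`_i *: 'X^i.
  by move=> sP; rewrite -poly_def; apply/polyP => i; rewrite coef_poly;
     case: ltnP => // le_i; rewrite nth_default // (leq_trans sP).
rewrite {1}(polyE d G) // {1}(polyE e H) // mulr_suml revpoly_sum.
rewrite {2}/revpoly mulr_suml; apply: eq_bigr => i _.
rewrite mulr_sumr revpoly_sum /revpoly mulr_sumr; apply: eq_bigr => j _.
rewrite -/(revpoly _ _) -scalerAl -scalerAr !revpolyZ -exprD revpolyXn; last first.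
  by have := ltn_ord i; have := ltn_ord j; lia.
rewrite -scalerAl -scalerAr -exprD !scalerA exprD.
have -> : (d + e - (i + j) = d - i + (e - j))%N.
  by have := ltn_ord i; have := ltn_ord j; lia.
by congr (_ *: _); ring.
Qed.

Lemma revpoly_tlin r : revpoly 1 (tlin r) = 'X - r%:P.
Proof.
rewrite /revpoly big_ord_recl big_ord1 /= coef0_tlin expr0 mul1r scale1r.
rewrite subn0 expr1 /bump /= subnn expr0 coefD coef1 coefZ coefX /= add0r mulr1.
by rewrite mulN1r scaleNr alg_polyC.
Qed.

Lemma revpoly_tlin_prod s :
  revpoly (size s) (\prod_(r <- s) tlin r) = \prod_(r <- s) ('X - r%:P).
Proof.
elim: s => [|r s IHs].
  by rewrite !big_nil /= -(expr0 'X) revpolyXn // expr0 scale1r.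
rewrite !big_cons -IHs -revpoly_tlin -revpolyM ?size_tlin //.
exact: size_tlin_prod.
Qed.

Lemma coef_revpoly d G i : (i <= d)%N ->
  (revpoly d G)`_(d - i) = (- 1) ^+ i * G`_i.
Proof.
move=> le_id; rewrite /revpoly coef_sum.
rewrite (bigD1 (Ordinal (le_id : i < d.+1)%N)) //=.
rewrite coefZ coefXn eqxx mulr1 big1 ?addr0 // => j ne_ji.
rewrite coefZ coefXn; case: eqP => [eq_ij|_]; last by rewrite mulr0.
by case/eqP: ne_ji; apply: val_inj => /=; have := ltn_ord j; lia.
Qed.

Lemma size_revpoly d G : (size (revpoly d G) <= d.+1)%N.
Proof.
rewrite /revpoly (leq_trans (size_sum _ _ _)) //; apply/bigmax_leqP => i _.
rewrite (leq_trans (size_scale_leq _ _)) // size_polyXn; lia.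
Qed.

Lemma revpoly_inj d G H : (size G <= d.+1)%N -> (size H <= d.+1)%N ->
  revpoly d G = revpoly d H -> G = H.
Proof.
move=> sG sH eqGH; apply/polyP => i; have [le_id|lt_di] := leqP i d; last first.
  by rewrite !nth_default // (leq_trans _ lt_di).
have := coef_revpoly G le_id; rewrite eqGH coef_revpoly //
  => /(congr1 ( *%R ((-1) ^+ i))).
by rewrite !mulrA -expr2 sqrr_sign !mul1r.
Qed.

(** The substitute for pairwise distinct roots over a ring with zero divisors. *)
Fixpoint regular_differences s : Prop :=
  if s is r :: s' then
    (forall r', r' \in s' -> mps_regular (r' - r)) /\ regular_differences s'
  else True.

(** The usual bound on the number of roots: once the factor of [r] is split off, the value of the
    cofactor at another root [r'] is killed by the nonzerodivisor [r' - r]. *)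
Lemma poly_regular_roots_eq0 s (P : {poly A}) :
    regular_differences s -> (forall r, r \in s -> P.[r] = 0) ->
  (size P <= size s)%N -> P = 0.
Proof.
elim: s P => [|r s IHs] P /=.
  by move=> _ _; rewrite leqn0 size_poly_eq0 => /eqP.
case=> reg_r reg_s P_s sP.
have /factor_theorem[Q eqP] : root P r by apply/eqP/P_s; rewrite inE eqxx.
suff Q0 : Q = 0 by rewrite eqP Q0 mul0r.
apply: IHs => // [r' s_r'|].
  have := P_s r'; rewrite eqP inE s_r' orbT hornerM hornerXsubC mulrC.
  by move=> /(_ isT)/reg_r; apply.
have [->|Q_neq0] := eqVneq Q 0; first by rewrite size_poly0.
by move: sP; rewrite eqP size_Mmonic ?monicXsubC // size_XsubC addn2.
Qed.

Lemma eq_tlin_prod s G : G`_0 = 1 -> (size G <= (size s).+1)%N ->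
    regular_differences s ->
    (forall r, r \in s -> (revpoly (size s) G).[r] = 0) ->
  G = \prod_(r <- s) tlin r.
Proof.
move=> G0 sG reg_s G_s; apply: (revpoly_inj sG); first exact: size_tlin_prod.
apply/eqP; rewrite -subr_eq0; apply/eqP/(poly_regular_roots_eq0 reg_s).
  move=> r s_r; rewrite hornerD hornerN G_s // revpoly_tlin_prod.
  by rewrite (big_rem r) //= hornerM hornerXsubC subrr mul0r subr0.
(* Both reversed polynomials are monic of degree [size s], so the top coefficient cancels and the
   difference falls within the root bound. *)
apply/leq_sizeP => j; rewrite leq_eqVlt => /orP[/eqP <-|lt_j].
  have := fun P => @coef_revpoly (size s) P 0 (leq0n _); rewrite subn0 => coefr.
  by rewrite coefB !coefr G0 coef0_tlin_prod subrr.
by rewrite coefB !nth_default ?subr0 // (leq_trans (size_revpoly _ _)).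
Qed.

Lemma tlin_prod_root s s' r : size s = size s' ->
    \prod_(a <- s) tlin a = \prod_(a <- s') tlin a -> r \in s ->
  \prod_(a <- s') (r - a) = 0.
Proof.
move=> eq_s /(congr1 (revpoly (size s))); rewrite {2}eq_s !revpoly_tlin_prod.
move=> /(congr1 (fun P : {poly A} => P.[r])); rewrite !horner_prod => eq_r s_r.
transitivity (\prod_(a <- s') ('X - a%:P).[r]).
  by apply: eq_bigr => a _; rewrite hornerXsubC.
by rewrite -eq_r (big_rem r) //= hornerXsubC subrr mul0r.
Qed.

Lemma mps_regular_eq (f a b : A) : mps_regular f -> f * (a - b) = 0 -> a = b.
Proof. by move=> f_reg /f_reg/eqP; rewrite subr_eq0 => /eqP. Qed.

End Reversal.

(** * Compositional inverses *)

Section Inversion.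
Context (R : comNzRingType).

Lemma point1 k (a : mps R k) : a 0%MM = 0 -> point [tuple a].
Proof. by move=> a0 i; rewrite ord1. Qed.

Lemma point2 k (a b : mps R k) :
  a 0%MM = 0 -> b 0%MM = 0 -> point [tuple a; b].
Proof.
by move=> a0 b0 i; rewrite (tnth_nth 0); case: i => [[|[|]]].
Qed.

Lemma point3 k (a b c : mps R k) :
  a 0%MM = 0 -> b 0%MM = 0 -> c 0%MM = 0 -> point [tuple a; b; c].
Proof.
by move=> a0 b0 c0 i; rewrite (tnth_nth 0); case: i => [[|[|[|]]]].
Qed.

Lemma subst1X k (a : mps R k) : a 0%MM = 0 -> subst1 (mpsX R ord0) a = a.
Proof. by move=> a0; rewrite /subst1 mpssubstX; first by []; apply: point1. Qed.

Lemma subst1M k f g (a : mps R k) : a 0%MM = 0 ->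
  subst1 (f * g) a = subst1 f a * subst1 g a.
Proof. by move=> a0; rewrite /subst1 mpssubstM //; apply: point1. Qed.

Lemma subst1_coef0 k f (a : mps R k) :
  a 0%MM = 0 -> subst1 f a 0%MM = f 0%MM.
Proof. by move=> a0; rewrite /subst1 mpssubst_coef0 //; apply: point1. Qed.

Lemma subst1_coef1 k f (a : mps R k) i : a 0%MM = 0 ->
  subst1 f a U_(i)%MM = f U_(ord0)%MM * a U_(i)%MM.
Proof.
by move=> a0; rewrite /subst1 mpssubst_coef1 ?big_ord1 //; apply: point1.
Qed.

Lemma subst1_comp n k f (a : mps R n) (g : n.-tuple (mps R k)) :
  point g -> a 0%MM = 0 -> mpssubst (subst1 f a) g = subst1 f (mpssubst a g).
Proof.
move=> g0 a0; rewrite /subst1 mpssubst_comp //; last exact: point1.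
congr (mpssubst f _); apply: eq_from_tnth => i.
by rewrite ord1 tnth_mktuple.
Qed.

Lemma mps1_divX (f : mps R 1) : f 0%MM = 0 -> exists g, f = mpsX R ord0 * g.
Proof.
move=> f0; apply: (mps_divX (i := ord0)); apply: mpsP => m; rewrite mpssubst_restr.
case: forallP => // m_0; suff -> : m = 0%MM by rewrite f0.
apply/mnmP => i; rewrite mnm0E; apply/eqP/negPn/negP => /(implyP (m_0 i)).
by rewrite [i]ord1 /=.
Qed.

Lemma subst1_congr k b (f : mps R 1) (a a' : mps R k) : a 0%MM = 0 -> a' 0%MM = 0 ->
  mpsord b (a - a') -> mpsord b (subst1 f a - subst1 f a').
Proof.
move=> a0 a'0 aa' m lt_m; rewrite mps_coefD mps_coefN /= -sumrB.
rewrite big1 // => i _; rewrite !big_ord1 -mulrBr -mps_coefN -mps_coefD subrXX.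
by rewrite (mpsordMr _ aa') ?mulr0.
Qed.

(** With f = X g, the expression equals (a - a')(g(a) - u) + a'(g(a) - g(a')), and g(a) has constant
    term u. The order gained drives both the injectivity of substitution and the convergence to the
    inverse. *)
Lemma subst1_linear_approx k b (f : mps R 1) (a a' : mps R k) :
    f 0%MM = 0 -> a 0%MM = 0 -> a' 0%MM = 0 -> mpsord b (a - a') ->
  mpsord b.+1 (subst1 f a - subst1 f a' - mpsC k (f U_(ord0)%MM) * (a - a')).
Proof.
move=> f0 a0 a'0 aa'; set u := f _.
have [g fE] := mps1_divX f0.
have gu : g 0%MM = u by rewrite /u fE mps_coef1M mpsX_coef0 mul0r add0r mpsX_coef1
  mul1r.
have -> : subst1 f a - subst1 f a' - mpsC k u * (a - a')
    = (a - a') * (subst1 g a - mpsC k u) + a' * (subst1 g a - subst1 g a').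
  by rewrite fE !subst1M // !subst1X //; ring.
apply: mpsordD; last first.
  by rewrite -add1n; apply: mpsordM; [apply/mpsord1P | apply: subst1_congr].
rewrite -addn1; apply: mpsordM => //; apply/mpsord1P.
by rewrite mps_coefD mps_coefN subst1_coef0 // mpsC_coef0 gu subrr.
Qed.

Section Invertible.
Context (f : mps R 1) (v : R).
Hypothesis (f0 : f 0%MM = 0) (vf1 : v * f U_(ord0)%MM = 1).

Lemma subst1_inj k (a a' : mps R k) : a 0%MM = 0 -> a' 0%MM = 0 ->
  subst1 f a = subst1 f a' -> a = a'.
Proof.
move=> a0 a'0 eq_f; apply/eqP; rewrite -subr_eq0; apply/eqP/mpsord_all0.
elim=> [//|b /(subst1_linear_approx f0 a0 a'0)].
rewrite eq_f subrr sub0r => /mpsordN; rewrite opprK => /(mpsordMl (mpsC k v)).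
by rewrite mulrA -rmorphM vf1 rmorph1 mul1r.
Qed.

(** Newton iteration with a fixed slope: [v] inverts the linear coefficient of [f], and each step
    raises the order of the error by one. *)
Fixpoint inverse_approx j : mps R 1 :=
  if j is j'.+1 then
    inverse_approx j' + mpsC 1 v * (mpsX R ord0 - subst1 f (inverse_approx j'))
  else 0.

Lemma inverse_approx_spec j : inverse_approx j 0%MM = 0 /\
  mpsord j.+1 (mpsX R ord0 - subst1 f (inverse_approx j)).
Proof.
elim: j => [|j [h0]] /=.
  by split=> //; apply/mpsord1P; rewrite mps_coefD mps_coefN subst1_coef0 //
    f0 mpsX_coef0 subr0.
set h := inverse_approx j; set e := _ - _ => e_ord.
have e0 : e 0%MM = 0 by rewrite e_ord ?mdeg0.
have h'0 : (h + mpsC 1 v * e) 0%MM = 0.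
  by rewrite mps_coefD mpsC_coefM e0 mulr0 addr0.
split=> //; have /(subst1_linear_approx f0 h'0 h0) : mpsord j.+1 (h + mpsC 1 v * e - h).
  by rewrite addrC addKr; apply: mpsordMl.
rewrite [h + _ - h]addrC addKr mulrA -rmorphM [_ * v]mulrC vf1 rmorph1 mul1r.
move=> /mpsordN; congr (mpsord _ _).
by rewrite /e; ring.
Qed.

(** The approximation of index [j] is final in degrees up to [j], so each coefficient is taken from
    the approximation indexed by its degree. *)
Definition inverse_series : mps R 1 := MPS (fun m => inverse_approx (mdeg m) m).

Lemma inverse_series_approx j :
  mpsord j.+1 (inverse_series - inverse_approx j).
Proof.
move=> m; rewrite ltnS mps_coefD mps_coefN /=.
move=> le_mj; rewrite -(subnK le_mj); elim: (j - mdeg m)%N => [|i IHi].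
  by rewrite add0n subrr.
rewrite addSn [inverse_approx _.+1]/= mps_coefD opprD addrA IHi sub0r mpsC_coefM.
have [_ ->] := inverse_approx_spec (i + mdeg m); last by rewrite ltnS leq_addl.
by rewrite mulr0 oppr0.
Qed.

Lemma inverse_series_coef0 : inverse_series 0%MM = 0.
Proof. by rewrite /= mdeg0. Qed.

Lemma subst1_inverse_series : subst1 f inverse_series = mpsX R ord0.
Proof.
apply/eqP; rewrite eq_sym -subr_eq0; apply/eqP/mpsord_all0 => b.
apply: (@mpsord_le _ _ _ b.+1) => //; set h := inverse_approx b.
have [h0 h_ord] := inverse_approx_spec b.
have -> : mpsX R ord0 - subst1 f inverse_series =
    mpsX R ord0 - subst1 f h - (subst1 f inverse_series - subst1 f h) by ring.
apply/mpsordB/subst1_congr => //; first exact: inverse_series_coef0.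
exact: inverse_series_approx.
Qed.

Lemma compinv_spec : compinv f 0%MM = 0 /\ subst1 f (compinv f) = mpsX R ord0.
Proof.
rewrite /compinv; case: xgetP => [h _ []//|].
move/(_ inverse_series) => []; split; last exact: subst1_inverse_series.
exact: inverse_series_coef0.
Qed.

Lemma subst1_compinv k (a : mps R k) : a 0%MM = 0 ->
  subst1 f (subst1 (compinv f) a) = a.
Proof.
have [h0 fh] := compinv_spec => a0.
have pa := point1 a0.
by rewrite -[subst1 (compinv f) a]/(mpssubst _ _) -subst1_comp // fh mpssubstX.
Qed.

Lemma compinv_subst1 k (a : mps R k) : a 0%MM = 0 ->
  subst1 (compinv f) (subst1 f a) = a.
Proof.
have [h0 fh] := compinv_spec => a0.
have fa0 : subst1 f a 0%MM = 0 by rewrite subst1_coef0.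
by apply: subst1_inj; rewrite ?subst1_coef0 // subst1_compinv.
Qed.

Lemma compinv_inverse_series : compinv f = inverse_series.
Proof.
have [h0 fh] := compinv_spec.
by apply: subst1_inj; rewrite ?inverse_series_coef0 // fh subst1_inverse_series.
Qed.

End Invertible.

End Inversion.

(** * Homogeneity and square roots *)

Section Grading.
Context (R : comNzRingType) (gr : grading R).

Lemma hpartN d a : gr d a -> gr d (- a).
Proof. by move=> da; rewrite -sub0r; apply: hpartB => //; apply: hpart0. Qed.

Lemma hpartD d a b : gr d a -> gr d b -> gr d (a + b).
Proof. by move=> da db; rewrite -[b]opprK; apply: hpartB => //; apply: hpartN. Qed.

Lemma hpart_sum d I (r : seq I) (P : pred I) (F : I -> R) :
  (forall i, P i -> gr d (F i)) -> gr d (\sum_(i <- r | P i) F i).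
Proof. by move=> dF; apply: big_ind => //; [apply: hpart0 | apply: hpartD]. Qed.

Lemma hpart_nat a : gr 0 a%:R.
Proof.
by elim: a => [|a IHa]; [apply: hpart0 | rewrite mulrS; apply: hpartD => //;
  apply: hpart1].
Qed.

(** Homogeneity of [half] has to be derived: comparing the components of 2 * half = 1 in degree 0
    gives 2 * c 0 = 1, and an inverse of 2 is unique. Here [c'] lists the components of 2 * half -
    1. *)
Lemma hpart_half half : 2 * half = 1 -> gr 0 half.
Proof.
move=> half2; have [s [c [uniq_s c_gr halfE]]] := hpart_span gr half.
pose c' d := (if d \in s then 2 * c d else 0) - (if d == 0 then 1 else 0).
pose s' := undup (0 :: s).
have c'_gr d : gr d (c' d).
  apply: hpartB; last by case: eqP => [->|_]; [apply: hpart1 | apply: hpart0].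
  case: ifP => _; last exact: hpart0.
  by have := hpartM (hpart_nat 2) (c_gr d); rewrite add0r.
have sum_c' : \sum_(d <- s') c' d = 0.
  rewrite sumrB [X in _ - X](bigD1_seq 0) ?undup_uniq ?mem_undup ?inE ?eqxx //=.
  rewrite [X in _ - (_ + X)]big1 => [|d /negbTE -> //]; rewrite addr0.
  rewrite [X in _ - X](_ : _ = \sum_(d <- s) 2 * c d); last first.
    by rewrite -mulr_sumr -halfE half2.
  rewrite -big_mkcond /= -big_filter; apply/eqP.
  rewrite subr_eq0; apply/eqP/esym; apply: perm_big; apply: uniq_perm => //.
    by rewrite filter_uniq ?undup_uniq.
  by move=> d; rewrite mem_filter mem_undup inE; case: (d \in s); rewrite ?orbT.
have := hpart_free (undup_uniq _) c'_gr sum_c' (d := 0).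
rewrite mem_undup inE eqxx /c' eqxx => /(_ isT).
case: ifP => [_|_ /eqP]; last by rewrite sub0r oppr_eq0 oner_eq0.
move/eqP; rewrite subr_eq0 => /eqP c02.
have -> : half = c 0.
  by rewrite -[half]mul1r -c02 mulrAC half2 mul1r.
exact: c_gr.
Qed.

(** Homogeneity for variables of an arbitrary degree [w]: the laws use [- 2], but the auxiliary
    series that produces square roots has a variable of degree 0. *)
Definition mpswt n (w d : int) (f : mps R n) :=
  forall m, gr (d - w * (mdeg m)%:Z) (f m).

Lemma mpshomogE n d (f : mps R n) : mpshomog gr d f <-> mpswt (- 2) d f.
Proof. by split=> fd m; have := fd m; rewrite mulNr opprK. Qed.

Section Closure.
Context (n : nat).
Implicit Types f g : mps R n.

Lemma mpswtB w d f g : mpswt w d f -> mpswt w d g -> mpswt w d (f - g).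
Proof. by move=> fd gd m; apply: hpartB. Qed.

Lemma mpswtD w d f g : mpswt w d f -> mpswt w d g -> mpswt w d (f + g).
Proof. by move=> fd gd m; apply: hpartD. Qed.

Lemma mpswtC w c : gr 0 c -> mpswt w 0 (mpsC n c).
Proof.
move=> c0 m /=; case: eqP => [->|_]; last exact: hpart0.
by rewrite mdeg0 mulr0 subr0.
Qed.

Lemma mpswt0 w d : mpswt w d (0 : mps R n).
Proof. by move=> m; apply: hpart0. Qed.

Lemma mpswt_nat w a : mpswt w 0 (a%:R : mps R n).
Proof. by rewrite -(rmorph_nat (@mpsC R n)); apply/mpswtC/hpart_nat. Qed.

Lemma mpswt1 w : mpswt w 0 (1 : mps R n).
Proof. exact: (mpswt_nat w 1). Qed.

Lemma mpswtX w i : mpswt w w (mpsX R i : mps R n).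
Proof.
move=> m /=; case: eqP => [->|_]; last exact: hpart0.
by rewrite mdeg1 mulr1 subrr; apply: hpart1.
Qed.

Lemma mpswtM w d e f g : mpswt w d f -> mpswt w e g -> mpswt w (d + e) (f * g).
Proof.
move=> fd ge m /=; apply: hpart_sum => -[k1 k2] /= /eqP mk.
have deg_m : (mdeg m)%:Z = (mdeg k1)%:Z + (mdeg k2)%:Z.
  by rewrite -PoszD -mdegD -mk.
by rewrite [X in _ * X]deg_m mulrDr opprD addrACA; exact: hpartM.
Qed.

Lemma mpswt_exp w d f a : mpswt w d f -> mpswt w (d * a%:Z) (f ^+ a).
Proof.
move=> fd; elim: a => [|a IHa]; first by rewrite mulr0; apply: mpswt1.
by rewrite exprS intS mulrDr mulr1; apply: mpswtM.
Qed.

Lemma mpswt_divX w d i f : mpswt w (d + w) (mpsX R i * f) -> mpswt w d f.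
Proof.
move=> fd m; have := fd (U_(i) + m)%MM; rewrite mps_coefM_single.
  rewrite /= eqxx mul1r mdegD mdeg1 PoszD mulrDr mulr1.
  by congr (gr _ _); ring.
by move=> k1 k2 _ /= /negbTE ->; rewrite mul0r.
Qed.

End Closure.

Lemma mpswt_subst n k w v d (f : mps R n) (g : n.-tuple (mps R k)) :
  mpswt w d f -> (forall i, mpswt v w (tnth g i)) -> mpswt v d (mpssubst f g).
Proof.
move=> fd gw m; apply: hpart_sum => a _.
have -> : d - v * (mdeg m)%:Z =
    d - w * (mdeg a)%:Z + (w * (mdeg a)%:Z - v * (mdeg m)%:Z).
  by rewrite addrA subrK.
apply: hpartM; first exact: fd.
suff: mpswt v (w * (mdeg a)%:Z) (\prod_(i < n) tnth g i ^+ a i) by apply.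
rewrite mdegE; elim/big_rec2: _ => [|i p b _ IH].
  by rewrite mulr0; apply: mpswt1.
by rewrite PoszD mulrDr; apply: mpswtM => //; apply: mpswt_exp.
Qed.

Lemma mpswt_subst1 k w v d f (a : mps R k) :
  mpswt w d f -> mpswt v w a -> mpswt v d (subst1 f a).
Proof. by move=> fd aw; apply: (mpswt_subst fd) => i; rewrite ord1. Qed.

Lemma mpswt_subst2 k w v d f (a b : mps R k) :
  mpswt w d f -> mpswt v w a -> mpswt v w b -> mpswt v d (subst2 f a b).
Proof.
move=> fd aw bw; apply: (mpswt_subst fd) => i.
by rewrite (tnth_nth 0); case: i => [[|[|]]].
Qed.

Lemma mpswt_compinv w (f : mps R 1) v : f 0%MM = 0 -> v * f U_(ord0)%MM = 1 -> gr 0 v ->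
  mpswt w w f -> mpswt w w (compinv f).
Proof.
move=> f0 vf1 v0 fw; rewrite (compinv_inverse_series f0 vf1) => m /=.
suff: mpswt w w (inverse_approx f v (mdeg m)) by apply.
elim: (mdeg m) => [|j IHj] /=; first exact: mpswt0.
apply: mpswtD => //; rewrite -[w]add0r; apply: mpswtM; first exact: mpswtC.
by rewrite add0r; apply: mpswtB; [apply: mpswtX | apply: mpswt_subst1 fw IHj].
Qed.

Section SquareRoot.
Context (half : R) (half2 : 2 * half = 1) (n : nat).

(** The equation for [s] is s(2 + s) = e, so [s] is the compositional inverse of x(2 + x) evaluated
    at [e]; this plays the part of the binomial series. *)
Lemma sqrt_1plus w (e : mps R n) : e 0%MM = 0 -> mpswt w 0 e ->
  exists s : mps R n, [/\ s 0%MM = 0, mpswt w 0 s & (1 + s) ^+ 2 = 1 + e].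
Proof.
move=> e0 ew; pose x := mpsX R (ord0 : 'I_1); pose h := x * (2 + x).
have h0 : h 0%MM = 0 by rewrite mps_coef0M mpsX_coef0 mul0r.
have h1 : half * h U_(ord0)%MM = 1.
  rewrite mps_coef1M mpsX_coef0 mul0r add0r mpsX_coef1 mul1r mps_coefD mpsX_coef0.
  by rewrite addr0 -(rmorph_nat (@mpsC R 1)) mpsC_coef0 mulrC.
have hw : mpswt 0 0 h.
  by rewrite -[X in mpswt _ X]addr0; apply: mpswtM;
     [|apply: mpswtD; first exact: mpswt_nat]; apply: mpswtX.
have [g0 _] := compinv_spec h0 h1; exists (subst1 (compinv h) e).
have s0 : subst1 (compinv h) e 0%MM = 0 by rewrite subst1_coef0.
split=> //.
  exact: mpswt_subst1 (mpswt_compinv h0 h1 (hpart_half half2) hw) ew.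
have := subst1_compinv h0 h1 e0; set s := subst1 _ e in s0 *.
have ps := point1 s0; rewrite /h subst1M // subst1X // [subst1 _ _]mpssubstD.
rewrite -(rmorph_nat (@mpsC R 1)) mpssubstC // rmorph_nat -/(subst1 x s) subst1X //.
by move=> <-; ring.
Qed.

Lemma sqrt_exists w i (U : mps R n) : U 0%MM = 16 -> mpswt w 0 U ->
  exists E, [/\ E ^+ 2 = mpsX R i ^+ 2 * U, mpsord 2 (E - 4 * mpsX R i) & mpswt w w E].
Proof.
move=> U0 Uw; have half_gr := hpart_half half2.
have half2C : 2 * mpsC n half = 1.
  by rewrite -(rmorph_nat (@mpsC R n) 2) -rmorphM half2 rmorph1.
(* As 16 is the fourth power of 2, this [e] has no constant term, and 4(1 + s) is a square root of
   [U]. *)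
pose e := mpsC n half ^+ 4 * U - 1.
have [||s [s0 sw sE]] := @sqrt_1plus w e.
- rewrite /e mps_coefD mps_coefN mps_coef0M -rmorphXn mpsC_coef0 U0.
  have -> : half ^+ 4 * 16 = (2 * half) ^+ 4 by ring.
  by rewrite half2 expr1n /= eqxx subrr.
- apply: mpswtB; last exact: mpswt1.
  rewrite -[X in mpswt _ X]addr0.
  apply: mpswtM => //; rewrite -[X in mpswt _ X](mul0r 4).
  by apply: mpswt_exp; apply: mpswtC.
exists (mpsX R i * (4 * (1 + s))); split.
- have -> : (mpsX R i * (4 * (1 + s))) ^+ 2 = mpsX R i ^+ 2 * (16 * (1 + s) ^+ 2) by
  ring.
  rewrite sE /e addrCA subrr addr0.
  have -> : 16 * (mpsC n half ^+ 4 * U) = (2 * mpsC n half) ^+ 4 * U by ring.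
  by rewrite half2C expr1n mul1r.
- have -> : mpsX R i * (4 * (1 + s)) - 4 * mpsX R i = mpsX R i * (4 * s) by ring.
  apply: (@mpsordM _ _ 1 1); apply/mpsord1P; first exact: mpsX_coef0.
  by rewrite mps_coef0M s0 mulr0.
rewrite -[X in mpswt _ X]addr0; apply: mpswtM; first exact: mpswtX.
rewrite -[X in mpswt _ X]addr0; apply: mpswtM; first exact: mpswt_nat.
by apply: mpswtD => //; apply: mpswt1.
Qed.

(** In the factorisation of E ^ 2 - E' ^ 2, the factor [E + E'] has linear coefficient 8 at [i],
    hence is a nonzerodivisor. *)
Lemma sqrt_unique i (E E' : mps R n) :
    mpsord 2 (E - 4 * mpsX R i) -> mpsord 2 (E' - 4 * mpsX R i) ->
  E ^+ 2 = E' ^+ 2 -> E = E'.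
Proof.
have lead (f : mps R n) : mpsord 2 (f - 4 * mpsX R i) ->
    f 0%MM = 0 /\ f U_(i)%MM = 4.
  case/mpsord2P => f0 /(_ i); move: f0; rewrite !mps_coefD !mps_coefN.
  rewrite -(rmorph_nat (@mpsC R n) 4) !mpsC_coefM mpsX_coef0 mpsX_coef1 eqxx.
  by rewrite mulr0 mulr1 subr0 => -> /eqP; rewrite subr_eq0 => /eqP ->.
move=> /lead[E0 E1] /lead[E'0 E'1] /eqP; rewrite -subr_eq0 subr_sqr => /eqP.
rewrite mulrC => EE'0; apply: mps_regular_eq EE'0.
move=> g; apply: (mps_reg1 (i := i) (v := half ^+ 3)) => //.
  by rewrite mps_coefD E0 E'0 addr0.
rewrite mps_coefD E1 E'1; have -> : half ^+ 3 * (4 + 4) = (2 * half) ^+ 3 by ring.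
by rewrite half2 expr1n.
Qed.

End SquareRoot.
End Grading.

(** * Substitution in series *)

Section SeriesInT.
Context (R : comNzRingType).

Lemma coef_tsubst n k (G : {poly mps R n}) (g : n.-tuple (mps R k)) i :
  point g -> (tsubst G g)`_i = mpssubst G`_i g.
Proof. by move=> g0; rewrite coef_map_id0 ?mpssubst0. Qed.

Lemma tsubst_tlin n k (r : mps R n) (g : n.-tuple (mps R k)) :
  point g -> tsubst (tlin r) g = tlin (mpssubst r g).
Proof.
move=> g0; apply/polyP => i; rewrite coef_tsubst // !coefD !coefZ !coef1 !coefX.
by rewrite mpssubstD mpssubstM // !mpssubst_nat.
Qed.

Lemma tsubstM n k (G H : {poly mps R n}) (g : n.-tuple (mps R k)) :
  point g -> tsubst (G * H) g = tsubst G g * tsubst H g.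
Proof. move=> g0; exact: (rmorphM (map_poly (substmor g0))). Qed.

Lemma tsubst_prod n k I (s : seq I) (P : pred I) (G : I -> {poly mps R n})
    (g : n.-tuple (mps R k)) : point g ->
  tsubst (\prod_(i <- s | P i) G i) g = \prod_(i <- s | P i) tsubst (G i) g.
Proof. move=> g0; exact: (rmorph_prod (map_poly (substmor g0))). Qed.

Lemma tsubst_comp n k l (G : {poly mps R n}) (g : n.-tuple (mps R k))
    (h : k.-tuple (mps R l)) : point g -> point h ->
  tsubst (tsubst G g) h = tsubst G [tuple mpssubst (tnth g i) h | i < n].
Proof.
move=> g0 h0; apply/polyP => i.
by rewrite !coef_tsubst ?mpssubst_comp //; apply: point_subst.
Qed.

Lemma tsubst3_comp k l (G : {poly mps R 3}) (a b c : mps R k)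
    (h : k.-tuple (mps R l)) : point h ->
    a 0%MM = 0 -> b 0%MM = 0 -> c 0%MM = 0 ->
  tsubst (tsubst3 G a b c) h =
  tsubst3 G (mpssubst a h) (mpssubst b h) (mpssubst c h).
Proof.
move=> h0 a0 b0 c0; rewrite /tsubst3 tsubst_comp //; last exact: point3.
congr (tsubst G _); apply: eq_from_tnth => i; rewrite tnth_mktuple !(tnth_nth 0).
by case: i => [[|[|[|]]]].
Qed.

Lemma mpssubst_splbase k m l (f : mps R k) (p : k.-tuple (mps R l))
    (s : m.-tuple (mps R l)) : point p -> point s ->
  mpssubst (splbase m f) [tuple of p ++ s] = mpssubst f p.
Proof.
move=> p0 s0; rewrite /splbase mpssubst_comp.
- congr (mpssubst f _); apply: eq_from_tnth => i; rewrite !tnth_mktuple mpssubstX.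
  + by rewrite tnth_lshift.
  + by move=> j; case: (split_ordP j) => j' ->; rewrite ?tnth_lshift ?tnth_rshift.
- by move=> i; rewrite tnth_mktuple mpsX_coef0.
- by move=> j; case: (split_ordP j) => j' ->; rewrite ?tnth_lshift ?tnth_rshift.
Qed.

(* Sending the root variables of the splitting algebra to actual roots kills
   its relations. *)
Lemma rootwise_split k m l (G H : {poly mps R k})
    (Phi : mps R (k + m) -> {poly mps R (k + m)}) (p : k.-tuple (mps R l))
    (s : m.-tuple (mps R l)) :
    point p -> point s -> rootwise G Phi H ->
    tsubst G p = \prod_(r <- s) tlin r ->
  tsubst H p = \prod_(i < m) tsubst (Phi (splroot R k i)) [tuple of p ++ s].
Proof.
move=> p0 s0 rootH GE; set q := [tuple of p ++ s].
have q0 : point q.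
  by move=> j; case: (split_ordP j) => j' ->; rewrite ?tnth_lshift ?tnth_rshift.
apply/polyP => j; rewrite -tsubst_prod // !coef_tsubst //.
have [c /(congr1 (fun f => mpssubst f q))] := rootH j.
rewrite mpssubstB // mpssubst_sum // [X in _ = X -> _]big1 => [|i _].
  by move=> /eqP; rewrite subr_eq0 mpssubst_splbase // => /eqP.
rewrite mpssubstM // -coef_tsubst // (_ : tsubst _ q = 0) ?coef0 ?mulr0 //.
rewrite /splrel [LHS](rmorphB (map_poly (substmor q0))).
apply/eqP; rewrite subr_eq0; apply/eqP.
transitivity (tsubst G p).
  rewrite [LHS](tsubst_prod _ _ _ q0) GE big_tuple; apply: eq_bigr => d _.
  by rewrite tsubst_tlin // mpssubstX // tnth_rshift.
apply/polyP => d; rewrite [RHS](coef_tsubst _ _ q0) coef_tsubst // coef_map_id0.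
  by rewrite mpssubst_splbase.
by rewrite /splbase mpssubst0 // => i'; rewrite tnth_mktuple mpsX_coef0.
Qed.


Lemma subst2_comp n k f (a b : mps R n) (g : n.-tuple (mps R k)) :
    point g -> a 0%MM = 0 -> b 0%MM = 0 ->
  mpssubst (subst2 f a b) g = subst2 f (mpssubst a g) (mpssubst b g).
Proof.
move=> g0 a0 b0; rewrite /subst2 mpssubst_comp //; last exact: point2.
congr (mpssubst f _); apply: eq_from_tnth => i; rewrite tnth_mktuple !(tnth_nth 0).
by case: i => [[|[|]]].
Qed.

Lemma subst2_coef0 k (f : mps R 2) (a b : mps R k) :
  a 0%MM = 0 -> b 0%MM = 0 -> subst2 f a b 0%MM = f 0%MM.
Proof. by move=> a0 b0; rewrite /subst2 mpssubst_coef0 //; apply: point2. Qed.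

Lemma subst2_coef1 k (f : mps R 2) (a b : mps R k) i :
    a 0%MM = 0 -> b 0%MM = 0 ->
  subst2 f a b U_(i)%MM = f U_(inord 0)%MM * a U_(i)%MM + f U_(inord 1)%MM * b U_(i)%MM.
Proof.
move=> a0 b0; rewrite /subst2 mpssubst_coef1; last exact: point2.
rewrite big_ord_recl big_ord1; congr (_ * _ + _ * _).
- by congr (f U_(_)%MM); apply: val_inj; rewrite /= inordK.
- by congr (f U_(_)%MM); apply: val_inj; rewrite /= inordK.
Qed.

Lemma mpssubstX_inord n k (g : n.+1.-tuple (mps R k)) j :
  point g -> (j < n.+1)%N -> mpssubst (mpsX R (inord j)) g = nth 0 g j.
Proof. by move=> g0 lt_j; rewrite mpssubstX // (tnth_nth 0) inordK. Qed.

Lemma mpsX_inord_coef1 n i j : (i < n.+1)%N -> (j < n.+1)%N ->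
  mpsX R (inord i : 'I_n.+1) U_(inord j)%MM = (i == j)%:R.
Proof.
by move=> lt_i lt_j; rewrite mpsX_coef1 -val_eqE /= !inordK // eq_sym.
Qed.

Lemma subst1_0 k (f : mps R 1) : f 0%MM = 0 -> subst1 f (0 : mps R k) = 0.
Proof. by move=> /mps1_divX[g ->]; rewrite subst1M // subst1X // mul0r. Qed.

Lemma subst2_id (f : mps R 2) :
  subst2 f (mpsX R (inord 0)) (mpsX R (inord 1)) = f.
Proof.
rewrite -[RHS]mpssubst_id; congr (mpssubst f _); apply: eq_from_tnth => i.
by rewrite tnth_mktuple (tnth_nth 0); case: i => [[|[|]]] //= lt_i;
  congr mpsX; apply: val_inj; rewrite /= inordK.
Qed.

Lemma tsubst3_id (G : {poly mps R 3}) :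
  tsubst3 G (mpsX R (inord 0)) (mpsX R (inord 1)) (mpsX R (inord 2)) = G.
Proof.
have -> : tsubst3 G (mpsX R (inord 0)) (mpsX R (inord 1)) (mpsX R (inord 2)) =
    tsubst G [tuple mpsX R i | i < 3].
  congr tsubst; apply: eq_from_tnth => i; rewrite tnth_mktuple (tnth_nth 0).
  by case: i => [[|[|[|]]]] //= lt_i; congr mpsX; apply: val_inj; rewrite /= inordK.
apply/polyP => i; rewrite coef_tsubst ?mpssubst_id // => j.
by rewrite tnth_mktuple mpsX_coef0.
Qed.

End SeriesInT.

(** * Formal ternary laws *)

#[local] Arguments mpscoef : simpl never.
(* Otherwise unification unfolds substitutions when it compares two of them. *)
Opaque mpssubst.
Create HintDb mps0.
#[local] Hint Resolve mpsX_coef0 point1 point2 point3 : mps0.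
#[local] Hint Extern 0 (mpscoef 0 _ = 0) => reflexivity : mps0.
#[local] Hint Extern 0 (mpscoef _ 0%MM = 0) => solve [auto with mps0 nocore] : core.
#[local] Hint Extern 0 (point _) => solve [auto with mps0 nocore] : core.

Section TernaryLaw.
Context (R : comNzRingType) (gr : grading R) (half : R).
Context (half2 : 2 * half = 1) (T : ternary R) (hT : is_FTL gr T).

Local Notation iota := (tiota T).
Local Notation Psi := (tPsi T).
Local Notation F := (tF T).
Local Notation inv a := (subst1 iota a).
Local Notation F3 := (tsubst3 F).
Local Notation linprod s := (\prod_(r <- s) tlin r).

Let half2C n : 2 * mpsC n half = 1.
Proof. by rewrite -(rmorph_nat (@mpsC R n) 2) -rmorphM half2 rmorph1. Qed.

Lemma mps_double_inj n (f g : mps R n) : 2 * f = 2 * g -> f = g.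
Proof. by move=> fg; rewrite -[f]mul1r -[g]mul1r -(half2C n) mulrAC fg mulrAC. Qed.

Lemma nat_coef0 n (a : nat) : (a%:R : mps R n) 0%MM = a%:R.
Proof. by rewrite -(rmorph_nat (@mpsC R n)) mpsC_coef0. Qed.

Lemma natM_coef n (a : nat) (f : mps R n) m : (a%:R * f) m = a%:R * f m.
Proof. by rewrite -(rmorph_nat (@mpsC R n)) mpsC_coefM. Qed.

(** * The framed involution *)

Let Psi_lead : Psi 0%MM = 0 /\ Psi U_(ord0)%MM = 1.
Proof.
case: hT => [[Psi_mod _ _ _] _]; split; rewrite Psi_mod ?mdeg0 ?mdeg1 //.
by rewrite mpsX_coef1 eqxx.
Qed.

Let Psi0 : Psi 0%MM = 0. Proof. by case: Psi_lead. Qed.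
Let Psi1 : 1 * Psi U_(ord0)%MM = 1. Proof. by case: Psi_lead => _ ->; rewrite mulr1.
  Qed.

Let iotaE : iota = mpsX R ord0 - 2 * Psi. Proof. by case: hT => [[]]. Qed.

Let iota0 : iota 0%MM = 0.
Proof.
by rewrite iotaE mps_coefD mps_coefN natM_coef mpsX_coef0 Psi0 mulr0 subr0.
Qed.

Lemma inv_coef0 k (a : mps R k) : a 0%MM = 0 -> inv a 0%MM = 0.
Proof. by move=> a0; rewrite subst1_coef0. Qed.

Lemma Psi_coef0 k (a : mps R k) : a 0%MM = 0 -> subst1 Psi a 0%MM = 0.
Proof. by move=> a0; rewrite subst1_coef0. Qed.

Hint Resolve inv_coef0 Psi_coef0 : mps0.

Lemma inv_coef1 k (a : mps R k) i : a 0%MM = 0 -> inv a U_(i)%MM = - a U_(i)%MM.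
Proof.
move=> a0; rewrite subst1_coef1 // iotaE mps_coefD mps_coefN natM_coef.
by case: Psi_lead => _ ->; rewrite mpsX_coef1 eqxx /=; ring.
Qed.

Lemma Psi_coef1 k (a : mps R k) i :
  a 0%MM = 0 -> subst1 Psi a U_(i)%MM = a U_(i)%MM.
Proof. by move=> a0; rewrite subst1_coef1 //; case: Psi_lead => _ ->; rewrite mul1r.
  Qed.

Lemma invE k (a : mps R k) : a 0%MM = 0 -> inv a = a - 2 * subst1 Psi a.
Proof.
move=> a0; have pa := point1 a0.
rewrite iotaE {1}/subst1 mpssubstB // mpssubstM // mpssubst_nat //.
by rewrite -[mpssubst (mpsX R ord0) _]/(subst1 _ _) subst1X.
Qed.

Lemma subst1_inv k (a : mps R k) n (g : k.-tuple (mps R n)) :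
  point g -> a 0%MM = 0 -> mpssubst (inv a) g = inv (mpssubst a g).
Proof. exact: subst1_comp. Qed.

Lemma invK k (a : mps R k) : a 0%MM = 0 -> inv (inv a) = a.
Proof.
move=> a0; have pa := point1 a0.
rewrite -[inv a in LHS]/(mpssubst _ _) -subst1_inv //.
by case: hT => [[_ _ _ ->]] _; rewrite mpssubstX.
Qed.

Lemma inv_0 k : inv 0 = 0 :> mps R k.
Proof. exact: subst1_0. Qed.

Lemma inv_inj k (a b : mps R k) : a 0%MM = 0 -> b 0%MM = 0 -> inv a = inv b -> a = b.
Proof. by move=> a0 b0 /(congr1 (subst1 iota)); rewrite !invK. Qed.

Lemma Psi_inj k (a b : mps R k) : a 0%MM = 0 -> b 0%MM = 0 ->
  subst1 Psi a = subst1 Psi b -> a = b.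
Proof. exact: (subst1_inj Psi0 Psi1). Qed.

(** Applying i(a) = a - 2 Psi(a) twice gives a = a - 2 Psi(a) - 2 Psi(i a), and 2 can be
    cancelled. *)
Lemma Psi_inv k (a : mps R k) : a 0%MM = 0 -> subst1 Psi (inv a) = - subst1 Psi a.
Proof.
move=> a0; apply: mps_double_inj; have := invK a0; rewrite invE; last by [].
rewrite [X in X - _]invE //; set b := subst1 Psi (inv a) => aE.
transitivity (a - 2 * subst1 Psi a - (a - 2 * subst1 Psi a - 2 * b)); first by ring.
by rewrite aE; ring.
Qed.

Lemma inv_fixed k (a : mps R k) : a 0%MM = 0 -> inv a = a -> a = 0.
Proof.
move=> a0 ia; apply: Psi_inj => //; rewrite [RHS]subst1_0 //.
apply: mps_double_inj; rewrite mulr0; move: ia; rewrite invE // => aE.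
have -> : 2 * subst1 Psi a = a - (a - 2 * subst1 Psi a) by ring.
by rewrite aE subrr.
Qed.

(** * The axioms at arbitrary power series *)

Lemma F3_comp k l (a b c : mps R k) (h : k.-tuple (mps R l)) :
    point h -> a 0%MM = 0 -> b 0%MM = 0 -> c 0%MM = 0 ->
  tsubst (F3 a b c) h = F3 (mpssubst a h) (mpssubst b h) (mpssubst c h).
Proof. exact: tsubst3_comp. Qed.

Lemma F3_coef0 k (a b c : mps R k) : a 0%MM = 0 -> b 0%MM = 0 -> c 0%MM = 0 ->
  (F3 a b c)`_0 = 1.
Proof.
move=> a0 b0 c0; case: hT => [_ [[_ F0 _] _]].
by rewrite coef_tsubst // F0 mpssubst1.
Qed.

Lemma size_F3 k (a b c : mps R k) : (size (F3 a b c) <= 5)%N.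
Proof.
by case: hT => [_ [[sF _ _] _]]; rewrite (leq_trans (size_poly _ _)).
Qed.

Lemma F3_perm k (a b c : mps R k) (s : {perm 'I_3}) :
    a 0%MM = 0 -> b 0%MM = 0 -> c 0%MM = 0 ->
  F3 a b c = tsubst F [tuple tnth [tuple a; b; c] (s i) | i < 3].
Proof.
move=> a0 b0 c0; case: hT => [_ [_ [_ F_sym _ _ _]]].
rewrite /tsubst3 -{1}(F_sym s) tsubst_comp //; last first.
  by move=> i; rewrite tnth_mktuple mpsX_coef0.
by congr tsubst; apply: eq_from_tnth => i; rewrite !tnth_mktuple mpssubstX.
Qed.

Lemma F3C12 k (a b c : mps R k) : a 0%MM = 0 -> b 0%MM = 0 -> c 0%MM = 0 ->
  F3 a b c = F3 b a c.
Proof.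
move=> a0 b0 c0; rewrite (F3_perm (tperm (inord 0) (inord 1))) //.
congr tsubst; apply: eq_from_tnth => i; rewrite tnth_mktuple !(tnth_nth 0).
case: tpermP => [->|->|/eqP]; rewrite ?inordK // => ne_i /eqP.
by move: ne_i; rewrite -!val_eqE /= !inordK //; case: i => [[|[|[|]]]].
Qed.

Lemma F3C23 k (a b c : mps R k) : a 0%MM = 0 -> b 0%MM = 0 -> c 0%MM = 0 ->
  F3 a b c = F3 a c b.
Proof.
move=> a0 b0 c0; rewrite (F3_perm (tperm (inord 1) (inord 2))) //.
congr tsubst; apply: eq_from_tnth => i; rewrite tnth_mktuple !(tnth_nth 0).
case: tpermP => [->|->|/eqP]; rewrite ?inordK // => ne_i /eqP.
by move: ne_i; rewrite -!val_eqE /= !inordK //; case: i => [[|[|[|]]]].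
Qed.

Lemma F3_00 k (a : mps R k) : a 0%MM = 0 ->
  F3 a 0 0 = linprod [:: a; a; inv a; inv a].
Proof.
move=> a0; have pa := point1 a0; case: hT => [_ [_ [F_unit _ _ _ _]]].
have := congr1 (fun G => tsubst G [tuple a]) F_unit.
have aX : mpssubst (mpsX R ord0) [tuple a] = a by rewrite mpssubstX.
rewrite /= tsubst3_comp // mpssubst0 // aX => ->.
rewrite tsubstM // !expr2 !tsubstM // !tsubst_tlin // subst1_comp // aX.
by rewrite !big_cons big_nil mulr1 !mulrA.
Qed.

(* Axiom (3) evaluated where both inner quadruples split. *)
Lemma F3_assoc k (a b c d e : mps R k) (s s' : 4.-tuple (mps R k)) :
    a 0%MM = 0 -> b 0%MM = 0 -> c 0%MM = 0 -> d 0%MM = 0 -> e 0%MM = 0 ->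
    point s -> point s' -> F3 a b c = linprod s -> F3 b c d = linprod s' ->
  \prod_(r <- s) F3 r d e = \prod_(r <- s') F3 a r e.
Proof.
move=> a0 b0 c0 d0 e0 ps ps' abcE bcdE; case: hT => [_ [_ [_ _ F_assoc _ _]]].
pose p := [tuple a; b; c; d; e]; have pp : point p.
  by move=> i; rewrite (tnth_nth 0); case: i => [[|[|[|[|[|]]]]]].
case: F_assoc => H [H1 H2].
have pq (t : 4.-tuple (mps R k)) : point t -> point [tuple of p ++ t].
  by move=> pt i; case: (split_ordP i) => j ->; rewrite ?tnth_lshift ?tnth_rshift.
have spl0 (f : mps R 5) : f 0%MM = 0 -> splbase 4 f 0%MM = 0.
  by move=> f0; rewrite /splbase mpssubst_coef0 // => i;
    rewrite tnth_mktuple mpsX_coef0.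
have root0 i : splroot R 5 (i : 'I_4) 0%MM = 0 by rewrite /splroot.
have rootE (t : 4.-tuple (mps R k)) i : point t ->
    mpssubst (splroot R 5 i) [tuple of p ++ t] = tnth t i.
  by move=> pt; rewrite /splroot (mpssubstX (pq _ pt)) tnth_rshift.
have := rootwise_split pp ps H1; rewrite tsubst3_comp // !mpssubstX_inord //.
move=> /(_ abcE); have := rootwise_split pp ps' H2; rewrite tsubst3_comp //.
rewrite !mpssubstX_inord // => /(_ bcdE) -> eqH.
rewrite !big_tuple; transitivity (\prod_(i < 4) tsubst (F3 (splroot R 5 i)
    (splbase 4 (mpsX R (inord 3))) (splbase 4 (mpsX R (inord 4)))) [tuple of p ++ s]).
  apply: eq_bigr => i _; rewrite tsubst3_comp ?root0 ?spl0 //.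
  by rewrite rootE // !mpssubst_splbase // !mpssubstX_inord.
rewrite -eqH; apply: eq_bigr => i _; rewrite tsubst3_comp ?root0 ?spl0 //.
by rewrite rootE // !mpssubst_splbase // !mpssubstX_inord.
Qed.

(** By axiom (1) both inner quadruples of axiom (3) at (a, 0, 0, b, c) consist of two double pairs,
    so the axiom compares F(a, b, c)^2 F(i a, b, c)^2 with F(a, b, c)^2 F(a, i b, c)^2. The common
    square cancels, and square roots with constant coefficient 1 are unique. *)
Lemma F3_inv k (a b c : mps R k) : a 0%MM = 0 -> b 0%MM = 0 -> c 0%MM = 0 ->
  F3 (inv a) b c = F3 a (inv b) c.
Proof.
move=> a0 b0 c0.
have point4 (d : mps R k) : d 0%MM = 0 -> point [tuple d; d; inv d; inv d].
  by move=> d0 i; rewrite (tnth_nth 0); case: i => [[|[|[|[|]]]]] //= _.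
have := @F3_assoc k a 0 0 b c [tuple a; a; inv a; inv a] [tuple b; b; inv b; inv b].
rewrite F3_00 // (@F3C23 _ 0) // (@F3C12 _ 0 b) // F3_00 // !big_cons !big_nil.
move=> /(_ a0 erefl erefl b0 c0 (point4 _ a0) (point4 _ b0) erefl erefl) eqF.
have {}eqF : F3 a b c * F3 a b c * F3 (inv a) b c ^+ 2 =
             F3 a b c * F3 a b c * F3 a (inv b) c ^+ 2.
  by rewrite !expr2 !mulrA; move: eqF; rewrite !mulr1 !mulrA.
apply: (poly_sqr_inj half2); rewrite ?F3_coef0 //; try by auto with mps0.
apply: (poly_coef0_mulI _ eqF); rewrite coef0M !F3_coef0 ?mulr1 //.
Qed.

Lemma one_coef0 n : (1 : mps R n) 0%MM = 1.
Proof. exact: (nat_coef0 n 1). Qed.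

Lemma coef_linprod4 k (a b c d : mps R k) :
  (linprod [:: a; b; c; d])`_1 = a + b + c + d /\
  (linprod [:: a; b; c; d])`_2 =
    a * b + a * c + a * d + b * c + b * d + c * d.
Proof.
have tlinE (r : mps R k) : tlin r = 1 + r%:P * 'X by rewrite /tlin mul_polyC.
rewrite !big_cons big_nil mulr1 !tlinE.
have -> : (1 + a%:P * 'X) * ((1 + b%:P * 'X) * ((1 + c%:P * 'X) * (1 + d%:P * 'X)))
  = 1 + (a + b + c + d)%:P * 'X
    + (a * b + a * c + a * d + b * c + b * d + c * d)%:P * 'X^2
    + (a * b * c + a * b * d + a * c * d + b * c * d)%:P * 'X^3
    + (a * b * c * d)%:P * 'X^4.
  by rewrite !rmorphD !rmorphM /=; ring.
by split; rewrite !coefD !coefCM !coefXn coef1 !coefX /=; ring.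
Qed.

Local Notation x := (mpsX R (inord 0 : 'I_2)).
Local Notation y := (mpsX R (inord 1 : 'I_2)).

Lemma subst2X0 k (a b : mps R k) : a 0%MM = 0 -> b 0%MM = 0 -> subst2 x a b = a.
Proof. by move=> a0 b0; rewrite /subst2 mpssubstX_inord. Qed.

Lemma subst2X1 k (a b : mps R k) : a 0%MM = 0 -> b 0%MM = 0 -> subst2 y a b = b.
Proof. by move=> a0 b0; rewrite /subst2 mpssubstX_inord. Qed.

Lemma subst2_subst2 k (f : mps R 2) (a b : mps R 2) (c d : mps R k) :
    a 0%MM = 0 -> b 0%MM = 0 -> c 0%MM = 0 -> d 0%MM = 0 ->
  subst2 (subst2 f a b) c d = subst2 f (subst2 a c d) (subst2 b c d).
Proof. by move=> a0 b0 c0 d0; rewrite -subst2_comp. Qed.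

Lemma subst2_inv k (a : mps R 2) (c d : mps R k) :
    a 0%MM = 0 -> c 0%MM = 0 -> d 0%MM = 0 ->
  subst2 (inv a) c d = inv (subst2 a c d).
Proof. by move=> a0 c0 d0; rewrite /subst2 subst1_inv. Qed.

Lemma subst2_sub0 (h : mps R 2) : subst2 h 0 y = 0 -> exists g, h = x * g.
Proof.
move=> h0; apply: mps_divX; rewrite -[RHS]h0; congr (mpssubst h _).
apply: eq_from_tnth => i; rewrite tnth_mktuple (tnth_nth 0) /=.
rewrite -val_eqE /= inordK //; case: i => [[|[|]]] //= lt_i; congr mpsX.
by apply: val_inj; rewrite /= inordK.
Qed.

Lemma iota_div : exists j, iota = mpsX R ord0 * j /\ j 0%MM = -1.
Proof.
have [j iotaX] := mps1_divX iota0; exists j; split=> //.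
have := congr1 (fun f : mps R 1 => f U_(ord0)%MM) iotaX.
rewrite mps_coef1M mpsX_coef0 mul0r add0r mpsX_coef1 eqxx mul1r => <-.
rewrite iotaE mps_coefD mps_coefN natM_coef mpsX_coef1 eqxx.
by case: Psi_lead => _ -> /=; ring.
Qed.

(** The term of first order in x must vanish. Write h - h(0, y) = x g and i x = x j with j = - 1 at
    x = 0: invariance gives j g(i x, y) = g, hence - g(0, y) = g(0, y), and g is divisible by x
    because 2 is invertible. *)
Lemma even_expansion (h : mps R 2) : subst2 h (inv x) y = h ->
  exists g, h = subst2 h 0 y + x ^+ 2 * g.
Proof.
move=> h_even; set h0 := subst2 h 0 y.
have h0_inv (c : mps R 2) : c 0%MM = 0 -> subst2 h0 c y = h0.
  by move=> c0; rewrite /h0 subst2_subst2 // subst2X1 // /subst2 mpssubst0.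
have subB (f g : mps R 2) (c d : mps R 2) : c 0%MM = 0 -> d 0%MM = 0 ->
    subst2 (f - g) c d = subst2 f c d - subst2 g c d.
  by move=> *; rewrite /subst2 mpssubstB.
have subM (f g : mps R 2) (c d : mps R 2) : c 0%MM = 0 -> d 0%MM = 0 ->
    subst2 (f * g) c d = subst2 f c d * subst2 g c d.
  by move=> *; rewrite /subst2 mpssubstM.
have [|g hE] := @subst2_sub0 (h - h0); first by rewrite subB // h0_inv // subrr.
have [j [iotaX j0]] := iota_div.
have invx : inv x = x * subst1 j x by rewrite {1}iotaX subst1M // subst1X.
have xg : inv x * subst2 g (inv x) y = x * g.
  by rewrite -{1}(@subst2X0 _ (inv x) y) // -subM // -hE subB // h_even h0_inv.
have g_odd : subst1 j x * subst2 g (inv x) y = g.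
  apply/eqP; rewrite -subr_eq0; apply/eqP/(mpsX_reg (i := inord 0)).
  by rewrite mulrBr mulrA -invx xg subrr.
have [|g' gE] := @subst2_sub0 g; last first.
  by exists g'; rewrite expr2 -mulrA -gE -hE addrC subrK.
have := congr1 (fun f => subst2 f 0 y) g_odd; rewrite /= subM // subst2_subst2 //.
rewrite subst2_inv // subst2X0 // subst2X1 // inv_0.
have -> : subst2 (subst1 j x) 0 y = -1.
  rewrite /subst2 subst1_comp // mpssubstX_inord //=.
  have [j' jE] : exists j', j = -1 + mpsX R ord0 * j'.
    have [j' j'E] : exists j', j + 1 = mpsX R ord0 * j'.
      by apply: mps1_divX; rewrite mps_coefD j0 one_coef0 addNr.
    by exists j'; rewrite -j'E addrC addrK.
  rewrite jE /subst1 mpssubstD mpssubstN mpssubst1 // mpssubstM // mpssubstX //.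
  by rewrite (tnth_nth 0) mul0r addr0.
rewrite mulN1r => gN; apply: mps_double_inj; rewrite mulr0 mulr_natl mulr2n.
by rewrite -{1}gN addNr.
Qed.

(** * The quadratic factor of F(x, x, y) *)

Definition quadpoly n (S P : mps R n) : {poly mps R n} := 1 + S *: 'X + P *: 'X^2.

Lemma quadpolyE n (S P : mps R n) : quadpoly S P = 1 + S%:P * 'X + P%:P * 'X^2.
Proof. by rewrite !mul_polyC. Qed.

Lemma coef_quadpoly n (S P : mps R n) :
  [/\ (quadpoly S P)`_0 = 1, (quadpoly S P)`_1 = S & (quadpoly S P)`_2 = P].
Proof.
by rewrite quadpolyE; split; rewrite !coefD coef1 !coefCM coefXn coefX /=; ring.
Qed.

Lemma quadpoly_inj n (S P S' P' : mps R n) :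
  quadpoly S P = quadpoly S' P' -> S = S' /\ P = P'.
Proof.
move=> eqSP; have [_ S1 P1] := coef_quadpoly S P.
have [_ S2 P2] := coef_quadpoly S' P'.
by split; [rewrite -S1 eqSP S2 | rewrite -P1 eqSP P2].
Qed.

Lemma tlinE n (r : mps R n) : tlin r = 1 + r%:P * 'X.
Proof. by rewrite mul_polyC. Qed.

Lemma quadpoly_tlinM n (a b : mps R n) : quadpoly (a + b) (a * b) = tlin a * tlin b.
Proof. by rewrite quadpolyE !tlinE rmorphD rmorphM /=; ring. Qed.

Definition dblS : mps R 2 := (F3 x x y)`_1 - 2 * y.
Definition dblP : mps R 2 := (F3 x x y)`_2 - 2 * y * dblS - y ^+ 2.
Definition dblD : mps R 2 := dblS ^+ 2 - 4 * dblP.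

Lemma F3_xxy : F3 x x y = tlin y ^+ 2 * quadpoly dblS dblP.
Proof.
case: hT => [_ [_ [_ _ _ _ [S [P FE]]]]].
suff [-> ->] : dblS = S /\ dblP = P by [].
have FE' : F3 x x y = 1 + (2 * y + S)%:P * 'X + (y ^+ 2 + 2 * y * S + P)%:P * 'X^2
    + (y ^+ 2 * S + 2 * y * P)%:P * 'X^3 + (y ^+ 2 * P)%:P * 'X^4.
  by rewrite FE -/(quadpoly S P) quadpolyE tlinE; ring.
have S1 : dblS = S.
  by rewrite /dblS FE' !coefD !coefCM !coefXn coef1 !coefX /=; ring.
split=> //; rewrite /dblP S1 FE' !coefD !coefCM !coefXn coef1 !coefX /=; ring.
Qed.

Lemma F3_aab k (a b : mps R k) : a 0%MM = 0 -> b 0%MM = 0 ->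
  F3 a a b = tlin b ^+ 2 * quadpoly (subst2 dblS a b) (subst2 dblP a b).
Proof.
move=> a0 b0; have pab := point2 a0 b0.
have := congr1 (fun G => tsubst G [tuple a; b]) F3_xxy.
rewrite /= F3_comp // !mpssubstX_inord //= => ->.
rewrite tsubstM // expr2 tsubstM // tsubst_tlin // mpssubstX_inord //= -expr2.
congr (_ * _); rewrite /quadpoly; apply/polyP => i; rewrite coef_tsubst //.
rewrite !coefD !coefZ !coefXn !coefX !coef1.
by rewrite !mpssubstD !mpssubstM // !mpssubst_nat.
Qed.

Lemma dblSP_inv k (a b : mps R k) : a 0%MM = 0 -> b 0%MM = 0 ->
  subst2 dblS (inv a) b = subst2 dblS a b /\
  subst2 dblP (inv a) b = subst2 dblP a b.
Proof.
move=> a0 b0; apply: quadpoly_inj.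
have b1 : (tlin b ^+ 2)`_0 = 1 by rewrite expr2 coef0M !coef0_tlin mulr1.
by apply: (poly_coef0_mulI b1); rewrite -!F3_aab // F3_inv // invK.
Qed.

Lemma dblSP_0 k (b : mps R k) : b 0%MM = 0 ->
  subst2 dblS 0 b = inv b + inv b /\ subst2 dblP 0 b = inv b * inv b.
Proof.
move=> b0; apply: quadpoly_inj; rewrite quadpoly_tlinM.
have b1 : (tlin b ^+ 2)`_0 = 1 by rewrite expr2 coef0M !coef0_tlin mulr1.
apply: (poly_coef0_mulI b1); rewrite -F3_aab // F3C23 // F3C12 // F3_00 //.
by rewrite !big_cons big_nil mulr1 expr2 !mulrA.
Qed.

(** Both expansions express invariance under the involution in x. The constant [- 4] is what makes
    the discriminant start with 16 x ^ 2. *)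
Lemma dbl_expansion : exists s p : mps R 2,
  [/\ dblS = 2 * inv y + x ^+ 2 * s, dblP = inv y ^+ 2 + x ^+ 2 * p & p 0%MM = - 4].
Proof.
have [S_inv P_inv] := dblSP_inv (mpsX_coef0 R _ : x 0%MM = 0) (mpsX_coef0 R _ : y
  0%MM = 0).
have [S_0 P_0] := dblSP_0 (mpsX_coef0 R _ : y 0%MM = 0).
rewrite !subst2_id in S_inv P_inv.
have [s sE] := even_expansion S_inv; have [p pE] := even_expansion P_inv.
exists s, p; rewrite S_0 in sE; rewrite P_0 in pE.
split; [by rewrite {1}sE; ring | by rewrite {1}pE expr2 |].
(* [K] is also even in x, so K = K(0, y) + x^2 q. By symmetry and axiom (1), K(t, 0) = K(0, t) = t^2
   (1 + 4 j + j^2), and with j = - 1 at the origin this makes the constant term of q equal to - 2.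
   On the diagonal K(t, t) = P(t, 0) = t^2 p(t, 0), so p has constant term - 2 - 2. *)
pose K := (F3 x y 0)`_2; pose t := mpsX R (ord0 : 'I_1).
have t0 : t 0%MM = 0 by apply: mpsX_coef0.
have K_at k (a b : mps R k) : a 0%MM = 0 -> b 0%MM = 0 -> subst2 K a b = (F3 a b 0)`_2.
  move=> a0 b0; rewrite /K /subst2 -coef_tsubst // F3_comp // mpssubst0 //.
  by rewrite !mpssubstX_inord.
have [|q qE] := @even_expansion K.
  by rewrite K_at // F3C23 // F3_inv // inv_0 F3C23.
have [j [iotaX j0]] := iota_div; rewrite -/t in iotaX.
have inv_t : inv t = t * j by rewrite -iotaX /subst1 -[RHS]mpssubst_id;
  congr (mpssubst _ _); apply: eq_from_tnth => i; rewrite tnth_mktuple ord1.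
have tt : t ^+ 2 * subst2 p t 0 = subst2 K t t.
  rewrite K_at // F3_aab // /tlin scale0r addr0 expr1n mul1r.
  have [_ _ ->] := coef_quadpoly (subst2 dblS t 0) (subst2 dblP t 0).
  rewrite pE expr2 {2}/subst2 mpssubstD !mpssubstM // -!/(subst2 _ t 0).
  by rewrite subst2_inv // subst2X1 // subst2X0 // inv_0 mul0r add0r.
have q_at (a b : mps R 1) : a 0%MM = 0 -> b 0%MM = 0 ->
    (F3 a b 0)`_2 = (F3 0 b 0)`_2 + a ^+ 2 * subst2 q a b.
  move=> a0 b0; rewrite -!K_at // {1}qE {1}/subst2 mpssubstD !mpssubstM //.
  by rewrite -!/(subst2 _ a b) subst2_subst2 // /subst2 mpssubst0 // !mpssubstX_inord.
have F0 : (F3 0 t 0)`_2 = t ^+ 2 * (1 + 4 * j + j ^+ 2).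
  rewrite F3C12 // F3_00 //; have [_ ->] := coef_linprod4 t t (inv t) (inv t).
  by rewrite inv_t; ring.
have t2_reg : mps_regular (t ^+ 2).
  by rewrite expr2; apply: mps_regularM; apply: mpsX_reg.
have qt0 : subst2 q t 0 = 1 + 4 * j + j ^+ 2.
  apply: (mps_regular_eq t2_reg); apply/eqP; rewrite mulrBr subr_eq0 -F0; apply/eqP.
  have := q_at t 0 t0 erefl; rewrite [F3 t 0 0]F3C12 // F3_00 //; have [_ ->] :=
    coef_linprod4 (0 : mps R 1) 0 (inv 0) (inv 0).
  by rewrite inv_0 !mulr0 !addr0 add0r => ->.
have q0 : q 0%MM = - 2.
  have := congr1 (fun f : mps R 1 => f 0%MM) qt0; rewrite subst2_coef0 // => ->.
  by rewrite !mps_coefD natM_coef one_coef0 expr2 mps_coef0M j0; ring.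
have ptt : subst2 p t 0 = 1 + 4 * j + j ^+ 2 + subst2 q t t.
  apply: (mps_regular_eq t2_reg); apply/eqP; rewrite mulrBr subr_eq0 tt; apply/eqP.
  by rewrite K_at // q_at // F0; ring.
have := congr1 (fun f : mps R 1 => f 0%MM) ptt; rewrite subst2_coef0 // => ->.
rewrite !mps_coefD natM_coef one_coef0 expr2 mps_coef0M j0 subst2_coef0 // q0.
ring.
Qed.

(** * The square root of the discriminant *)

Lemma dblS_wt : mpswt gr (- 2) (- 2) dblS.
Proof.
apply: mpswtB; last by rewrite -[X in mpswt _ _ X]add0r; apply: mpswtM;
  [apply: mpswt_nat | apply: mpswtX].
rewrite coef_tsubst //; case: hT => [_ [[_ _ F_homog] _]].
apply: (mpswt_subst (w := - 2)); first by have /mpshomogE := F_homog 1%N; rewrite mulr1.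
by move=> i; rewrite (tnth_nth 0); case: i => [[|[|[|]]]] //= _; apply: mpswtX.
Qed.

Lemma dblD_wt : mpswt gr (- 2) (- 2 + - 2) dblD.
Proof.
have y_wt := @mpswtX _ gr 2 (- 2) (inord 1).
apply: mpswtB; first by rewrite expr2; apply: mpswtM; apply: dblS_wt.
rewrite -[X in mpswt _ _ X]add0r; apply: mpswtM; first exact: mpswt_nat.
apply: mpswtB; last by rewrite expr2; apply: mpswtM.
apply: mpswtB; last first.
  by apply: mpswtM dblS_wt; rewrite -[X in mpswt _ _ X]add0r; apply: mpswtM => //;
    apply: mpswt_nat.
rewrite coef_tsubst //; case: hT => [_ [[_ _ F_homog] _]].
apply: (mpswt_subst (w := - 2)); first by have /mpshomogE := F_homog 2%N.
by move=> i; rewrite (tnth_nth 0); case: i => [[|[|[|]]]] //= _; apply: mpswtX.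
Qed.

(** Literally the choice made inside [GG], so that [GG half T] is convertible to an expression in
    [dblE]. *)
Definition dblE : mps R 2 :=
  xget 0 [set E : mps R 2 | E ^+ 2 = dblD /\ mpseqmod 2 E (4 * x)]%classic.

Lemma dblE_spec : [/\ dblE ^+ 2 = dblD, mpsord 2 (dblE - 4 * x) &
  mpswt gr (- 2) (- 2) dblE].
Proof.
have [s [p [SE PE p0]]] := dbl_expansion.
pose U := 4 * inv y * s + x ^+ 2 * s ^+ 2 - 4 * p.
have DU : dblD = x ^+ 2 * U by rewrite /dblD SE PE /U; ring.
have U0 : U 0%MM = 16.
  rewrite /U !mps_coefD mps_coefN !expr2 !mps_coef0M inv_coef0 // mpsX_coef0 p0.
  by rewrite nat_coef0; ring.
have Uw : mpswt gr (- 2) 0 U.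
  (* The degree of [U] is read off the discriminant, of degree - 4, by dividing by x twice. *)
  do 2!apply: (@mpswt_divX _ gr _ _ _ (inord 0)).
  by rewrite add0r mulrA -expr2 -DU; apply: dblD_wt.
have [E [E2 E_lead E_wt]] := sqrt_exists half2 (inord 0) U0 Uw.
have eqmodP G : mpseqmod 2 G (4 * x) <-> mpsord 2 (G - 4 * x).
  split=> GE m lt_m; first by rewrite mps_coefD mps_coefN GE // subrr.
  by have /eqP := GE m lt_m; rewrite mps_coefD mps_coefN subr_eq0 => /eqP.
have [dE2 dE_lead] : dblE ^+ 2 = dblD /\ mpseqmod 2 dblE (4 * x).
  rewrite /dblE; case: xgetP => [G _ //|/(_ E)[]].
  by split; [rewrite E2 | apply/eqmodP].
have dEE : dblE = E.
  by apply: (sqrt_unique half2 (i := inord 0)) => //; [apply/eqmodP | rewrite dE2 E2].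
by split; rewrite // dEE.
Qed.

Let dblE_0 : dblE 0%MM = 0.
Proof.
have [_ /mpsord2P[E0 _] _] := dblE_spec; move: E0.
by rewrite mps_coefD mps_coefN natM_coef mpsX_coef0 mulr0 subr0.
Qed.

Lemma dblE_coef1 i : (i < 2)%N -> dblE U_(inord i)%MM = 4 * (i == 0%N)%:R.
Proof.
move=> lt_i; have [_ /mpsord2P[_ E1] _] := dblE_spec; move/eqP: (E1 (inord i)).
rewrite mps_coefD mps_coefN natM_coef mpsX_inord_coef1 // subr_eq0 eq_sym.
by move=> /eqP <-; rewrite [0%N == i]eq_sym.
Qed.

(** The discriminant is even in x, while i x = - x + ...; so - E(i x, y) is another square root of
    it with leading term 4 x, and uniqueness applies. *)
Lemma dblE_inv k (a b : mps R k) : a 0%MM = 0 -> b 0%MM = 0 ->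
  subst2 dblE (inv a) b = - subst2 dblE a b.
Proof.
have univ : subst2 dblE (inv x) y = - dblE.
  have [E2 E_lead _] := dblE_spec; have pxy :=
    point2 (inv_coef0 (mpsX_coef0 R (inord 0 : 'I_2))) (mpsX_coef0 R (inord 1 : 'I_2)).
  apply/eqP; rewrite -[X in X == _]opprK eqr_opp; apply/eqP.
  apply: (sqrt_unique half2 (i := inord 0)) => //.
    apply/mpsord2P; split=> [|i]; rewrite mps_coefD !mps_coefN natM_coef.
      by rewrite subst2_coef0 // dblE_0 mpsX_coef0 mulr0 oppr0 addr0.
    rewrite subst2_coef1 // !dblE_coef1 // inv_coef1 //=; ring.
  rewrite sqrrN /subst2 -mpssubst_exp // E2 /dblD.
  rewrite mpssubstB // !mpssubst_exp // mpssubstM // mpssubst_nat //.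
  have [S_inv P_inv] :=
    dblSP_inv (mpsX_coef0 R _ : x 0%MM = 0) (mpsX_coef0 R _ : y 0%MM = 0).
  by rewrite !subst2_id in S_inv P_inv; rewrite -!/(subst2 _ _ _) S_inv P_inv.
move=> a0 b0; have pab := point2 a0 b0.
have := congr1 (fun f => subst2 f a b) univ.
rewrite /= subst2_subst2 // subst2_inv // subst2X0 // subst2X1 // => ->.
by rewrite /subst2 mpssubstN.
Qed.

(** The quadratic formula for the two roots of F(x, x, y) other than y, y. Their linear parts 2 x -
    y, here, and - 2 x - y, for [dblB], tell them apart. *)
Definition dblA : mps R 2 := mpsC 2 half * (dblS + dblE).
Definition dblB : mps R 2 := mpsC 2 half * (dblS - dblE).
Local Notation A := (subst2 dblA).
Local Notation B := (subst2 dblB).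

Lemma dblS_lead : dblS 0%MM = 0 /\
  forall i, (i < 2)%N -> dblS U_(inord i)%MM = - 2 * (i == 1%N)%:R.
Proof.
have [s [p [-> _ _]]] := dbl_expansion.
have xs_ord : mpsord 2 (x ^+ 2 * s).
  by apply: mpsordMr; apply: mpsordX; apply: mpsX_coef0.
split=> [|i lt_i]; rewrite mps_coefD natM_coef xs_ord ?mdeg0 ?mdeg1 // addr0.
  by rewrite inv_coef0 // mulr0.
by rewrite inv_coef1 // mpsX_inord_coef1 // [1%N == _]eq_sym; ring.
Qed.

Lemma dblAB_coef0 : dblA 0%MM = 0 /\ dblB 0%MM = 0.
Proof.
by have [S0 _] := dblS_lead; split; rewrite mpsC_coefM mps_coefD ?mps_coefN S0
  dblE_0 ?subr0 ?addr0 mulr0.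
Qed.

Lemma dblAB_coef1 : [/\ dblA U_(inord 0)%MM = 2, dblA U_(inord 1)%MM = - 1,
  dblB U_(inord 0)%MM = - 2 & dblB U_(inord 1)%MM = - 1].
Proof.
have [_ S1] := dblS_lead.
split; rewrite mpsC_coefM mps_coefD ?mps_coefN S1 // dblE_coef1 //=.
- by transitivity ((2 * half) * 2); [ring | rewrite half2 mul1r].
- by transitivity (- (2 * half)); [ring | rewrite half2].
- by transitivity (- ((2 * half) * 2)); [ring | rewrite half2 mul1r].
- by transitivity (- (2 * half)); [ring | rewrite half2].
Qed.

Lemma A_coef0 k (a b : mps R k) : a 0%MM = 0 -> b 0%MM = 0 -> A a b 0%MM = 0.
Proof. by move=> a0 b0; rewrite subst2_coef0 //; case: dblAB_coef0. Qed.

Lemma B_coef0 k (a b : mps R k) : a 0%MM = 0 -> b 0%MM = 0 -> B a b 0%MM = 0.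
Proof. by move=> a0 b0; rewrite subst2_coef0 //; case: dblAB_coef0. Qed.

Hint Resolve A_coef0 B_coef0 : mps0.

Lemma A_coef1 k (a b : mps R k) i : a 0%MM = 0 -> b 0%MM = 0 ->
  A a b U_(i)%MM = 2 * a U_(i)%MM - b U_(i)%MM.
Proof.
by move=> a0 b0; rewrite subst2_coef1 //; case: dblAB_coef1 => -> -> _ _; ring.
Qed.

Lemma B_coef1 k (a b : mps R k) i : a 0%MM = 0 -> b 0%MM = 0 ->
  B a b U_(i)%MM = - 2 * a U_(i)%MM - b U_(i)%MM.
Proof.
by move=> a0 b0; rewrite subst2_coef1 //; case: dblAB_coef1 => _ _ -> ->; ring.
Qed.

Lemma F3_double k (a b : mps R k) : a 0%MM = 0 -> b 0%MM = 0 ->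
  F3 a a b = linprod [:: b; b; A a b; B a b].
Proof.
move=> a0 b0; have pab := point2 a0 b0; rewrite F3_aab //.
rewrite !big_cons big_nil mulr1 [RHS]mulrA -expr2; congr (_ * _).
have [E2 _ _] := dblE_spec.
have sumAB : dblA + dblB = dblS.
  by transitivity (2 * mpsC 2 half * dblS); [rewrite /dblA /dblB;
    ring | rewrite half2C mul1r].
have prodAB : dblA * dblB = dblP.
  transitivity (mpsC 2 half ^+ 2 * (dblS ^+ 2 - dblE ^+ 2));
    first by rewrite /dblA /dblB; ring.
  rewrite E2 /dblD; transitivity ((2 * mpsC 2 half) ^+ 2 * dblP); first by ring.
  by rewrite half2C expr1n mul1r.
by rewrite -quadpoly_tlinM /subst2 -mpssubstD -mpssubstM // sumAB prodAB.
Qed.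

Let A_E k (a b : mps R k) : a 0%MM = 0 -> b 0%MM = 0 ->
  A a b = mpsC k half * (subst2 dblS a b + subst2 dblE a b).
Proof.
move=> a0 b0; have pab := point2 a0 b0.
by rewrite /subst2 mpssubstM // mpssubstD mpssubstC.
Qed.

Let B_E k (a b : mps R k) : a 0%MM = 0 -> b 0%MM = 0 ->
  B a b = mpsC k half * (subst2 dblS a b - subst2 dblE a b).
Proof.
move=> a0 b0; have pab := point2 a0 b0.
by rewrite /subst2 mpssubstM // mpssubstB // mpssubstC.
Qed.

Lemma A_inv k (a b : mps R k) : a 0%MM = 0 -> b 0%MM = 0 -> A (inv a) b = B a b.
Proof.
move=> a0 b0; rewrite A_E // B_E // dblE_inv //.
by have [-> _] := dblSP_inv a0 b0.
Qed.

Lemma B_0 k (b : mps R k) : b 0%MM = 0 -> B 0 b = inv b.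
Proof.
move=> b0; have E0 : subst2 dblE 0 b = 0.
  apply: mps_double_inj; rewrite mulr0 mulr_natl mulr2n.
  by rewrite -{1}(inv_0 k) dblE_inv // addNr.
rewrite B_E // E0 subr0.
have [-> _] := dblSP_0 b0.
by transitivity (2 * mpsC k half * inv b); [ring | rewrite half2C mul1r].
Qed.

(** * Consequences of axiom (4) *)

Let compinvPsi0 : compinv Psi 0%MM = 0.
Proof. by case: (compinv_spec Psi0 Psi1). Qed.

Lemma comp_tlin_opp n (r : mps R n) : tlin r \Po (- 'X) = tlin (- r).
Proof. by rewrite /tlin rmorphD /= comp_polyC comp_polyZ comp_polyX scalerN scaleNr.
  Qed.

(* Axiom (4) evaluated where both quadruples split. *)
Lemma F3_odd k (a b c : mps R k) (s s' : 4.-tuple (mps R k)) :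
    a 0%MM = 0 -> b 0%MM = 0 -> c 0%MM = 0 -> point s -> point s' ->
    F3 a b c = linprod s -> F3 (inv a) b c = linprod s' ->
  \prod_(r <- s') tlin (subst1 Psi r) = \prod_(r <- s) tlin (- subst1 Psi r).
Proof.
move=> a0 b0 c0 ps ps' abcE iabcE;
  case: hT => [_ [_ [_ _ _ [Fhat [FhatE Fhat_odd]] _]]].
pose G := tsubst F [tuple subst1 (compinv Psi) (mpsX R i) | i < 3].
have pX : point [tuple subst1 (compinv Psi) (mpsX R i) | i < 3].
  by move=> i; rewrite tnth_mktuple subst1_coef0 ?mpsX_coef0.
pose P (a' b' c' : mps R k) := [tuple subst1 Psi a'; subst1 Psi b'; subst1 Psi c'].
(* At the point with coordinates Psi(a'), Psi(b'), Psi(c') the inverse of Psi built into the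
   transport cancels, so the quadruple transported is F(a', b', c') itself. *)
have Fhat_at (a' b' c' : mps R k) (t : 4.-tuple (mps R k)) :
    a' 0%MM = 0 -> b' 0%MM = 0 -> c' 0%MM = 0 -> point t ->
    F3 a' b' c' = linprod t ->
    tsubst Fhat (P a' b' c') = \prod_(r <- t) tlin (subst1 Psi r).
  move=> a'0 b'0 c'0 pt F'E; have pP : point (P a' b' c') by apply: point3;
    auto with mps0.
  have := rootwise_split pP pt FhatE; rewrite tsubst_comp // => ->.
    rewrite big_tuple; apply: eq_bigr => i _.
    have pq : point [tuple of P a' b' c' ++ t].
      by move=> j; case: (split_ordP j) => j' ->; rewrite ?tnth_lshift ?tnth_rshift.
    by rewrite tsubst_tlin // subst1_comp ?mpsX_coef0 // mpssubstX // tnth_rshift.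
  rewrite -F'E /tsubst3; congr tsubst; apply: eq_from_tnth => i.
  rewrite !tnth_mktuple subst1_comp ?mpsX_coef0 // mpssubstX //.
  rewrite !(tnth_nth 0); case: i => [[|[|[|]]]] //= _;
    exact: (compinv_subst1 Psi0 Psi1).
rewrite -(Fhat_at _ _ _ _ _ _ _ _ iabcE) //.
have pP : point (P a b c) by apply: point3; auto with mps0.
transitivity (tsubst Fhat (P a b c) \Po (- 'X)).
  transitivity (tsubst (Fhat \Po (- 'X)) (P a b c)); last first.
    rewrite /tsubst (map_comp_poly (substmor pP)) rmorphN /=.
    by rewrite [map_poly _ 'X](map_polyX (substmor pP)).
  rewrite -Fhat_odd tsubst3_comp //; last by rewrite mps_coefN mpsX_coef0 oppr0.
  rewrite mpssubstN !mpssubstX_inord //= -Psi_inv //.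
rewrite (Fhat_at _ _ _ _ _ _ _ _ abcE) // rmorph_prod /=.
by apply: eq_bigr => r _; rewrite comp_tlin_opp.
Qed.

Lemma point4 k (a b c d : mps R k) : a 0%MM = 0 -> b 0%MM = 0 -> c 0%MM = 0 ->
  d 0%MM = 0 -> point [tuple a; b; c; d].
Proof.
by move=> a0 b0 c0 d0 i; rewrite (tnth_nth 0); case: i => [[|[|[|[|]]]]] //= _.
Qed.

Hint Resolve point4 : mps0.

(** Signed powers of 2 are the units that can be relied on over an arbitrary Z[1/2]-algebra; the
    matching of roots by linear parts uses only these. *)
Lemma mps_reg_nat n (i : 'I_n) (a b : nat) (f : mps R n) :
  f 0%MM = 0 -> f U_(i)%MM = 2 ^+ a * (- 1) ^+ b -> mps_regular f.
Proof.
move=> f0 f1 g; apply: (mps_reg1 f0 f1 (v := half ^+ a * (- 1) ^+ b)).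
rewrite mulrACA -!exprMn [half * 2]mulrC half2 !expr1n mul1r.
by rewrite mulrNN mulr1 expr1n.
Qed.

(** Axiom (4) sends the roots of F(x, x, y) to those of F(i x, x, y) = F(x, x, i y). After the
    double root i y is cancelled, A(x, i y), with linear part 2 x + y, must be i A or i B, with
    linear parts - 2 x + y and 2 x + y; the difference from i A, after Psi, starts with 4 x and is
    cancelled. *)
Lemma A_inv_r k (a b : mps R k) : a 0%MM = 0 -> b 0%MM = 0 ->
  A a (inv b) = inv (B a b).
Proof.
(* Linear parts separate the roots only for independent variables; arbitrary [a], [b] are
   substituted afterwards. *)
have univ : A x (inv y) = inv (B x y).
  have x0 : x 0%MM = 0 by apply: mpsX_coef0.
  have y0 : y 0%MM = 0 by apply: mpsX_coef0.
  have FE : F3 (inv x) x y = linprod [:: inv y; inv y; A x (inv y); B x (inv y)].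
    by rewrite F3C23 // F3_inv // F3C23 // F3_double.
  have := F3_odd (s := [tuple y; y; A x y; B x y])
    (s' := [tuple inv y; inv y; A x (inv y); B x (inv y)]) x0 x0 y0.
  move=> /(_ (point4 y0 y0 (A_coef0 x0 y0) (B_coef0 x0 y0))).
  move=> /(_ (point4 (inv_coef0 y0) (inv_coef0 y0) (A_coef0 x0 (inv_coef0 y0))
    (B_coef0 x0 (inv_coef0 y0))) (F3_double x0 y0) FE).
  rewrite !big_cons !big_nil !mulr1 Psi_inv //.
  move=> /(poly_coef0_mulI (coef0_tlin _))/(poly_coef0_mulI (coef0_tlin _)) eqAB.
  have := @tlin_prod_root _ _ [:: subst1 Psi (A x (inv y)); subst1 Psi (B x (inv y))]
    [:: - subst1 Psi (A x y); - subst1 Psi (B x y)] (subst1 Psi (A x (inv y))) erefl.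
  rewrite !big_cons !big_nil !mulr1 inE eqxx => /(_ eqAB isT) root0.
  apply: Psi_inj; try by auto 6 with mps0.
  rewrite Psi_inv; last by auto with mps0.
  apply: mps_regular_eq root0; apply: (mps_reg_nat (i := inord 0) (a := 2) (b := 0)).
    by rewrite mps_coefD !mps_coefN !Psi_coef0 ?oppr0 ?addr0 //; auto 6 with mps0.
  rewrite mps_coefD !mps_coefN !Psi_coef1 ?A_coef1 ?inv_coef1; try by auto 6 with mps0.
  by rewrite !mpsX_inord_coef1 //=; ring.
move=> a0 b0; have pab := point2 a0 b0.
have := congr1 (fun f => subst2 f a b) univ; rewrite /=.
by rewrite subst2_inv // ?subst2_subst2 // ?subst2_inv // ?subst2X0 // ?subst2X1.
Qed.

Lemma mps0_coef n i : (0 : mps R n) i = 0.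
Proof. by []. Qed.

(** * The series [dblf] and the candidate formal group law *)

Definition dblf : mps R 2 := subst2 dblB (inv x) (inv y).
Definition dbl2 : mps R 1 := subst2 dblf (mpsX R (ord0 : 'I_1)) 0.
Local Notation mu := (GG half T).
Local Notation m a b := (subst2 mu a b).
Local Notation h a := (subst1 (compinv dbl2) a).

Lemma f_E k (a b : mps R k) : a 0%MM = 0 -> b 0%MM = 0 ->
  subst2 dblf a b = B (inv a) (inv b).
Proof.
by move=> a0 b0; rewrite subst2_subst2 // !subst2_inv // subst2X0 // subst2X1.
Qed.

(** Together with [B_f] this writes the nontrivial roots of F(a, a, b) as f(a, i b) and i f(a, b),
    the shape that the roots of T(mu) require. *)
Lemma A_f k (a b : mps R k) : a 0%MM = 0 -> b 0%MM = 0 ->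
  A a b = subst2 dblf a (inv b).
Proof. by move=> a0 b0; rewrite f_E ?invK -?A_inv ?invK //; auto with mps0. Qed.

Lemma B_f k (a b : mps R k) : a 0%MM = 0 -> b 0%MM = 0 ->
  B a b = inv (subst2 dblf a b).
Proof.
by move=> a0 b0; rewrite -[b in RHS]invK // -A_f ?A_inv_r ?invK //; auto with mps0.
Qed.

Lemma f_inv k (a b : mps R k) : a 0%MM = 0 -> b 0%MM = 0 ->
  inv (subst2 dblf a b) = subst2 dblf (inv a) (inv b).
Proof. by move=> a0 b0; rewrite -B_f // f_E ?invK //; auto with mps0. Qed.

Lemma f_0 k (b : mps R k) : b 0%MM = 0 -> subst2 dblf 0 b = b.
Proof. by move=> b0; rewrite f_E // inv_0 B_0 ?invK //; auto with mps0. Qed.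

Lemma f_coef0 k (a b : mps R k) : a 0%MM = 0 -> b 0%MM = 0 ->
  subst2 dblf a b 0%MM = 0.
Proof. by move=> a0 b0; rewrite f_E //; auto with mps0. Qed.

Hint Resolve f_coef0 : mps0.

Lemma f_coef1 k (a b : mps R k) i : a 0%MM = 0 -> b 0%MM = 0 ->
  subst2 dblf a b U_(i)%MM = 2 * a U_(i)%MM + b U_(i)%MM.
Proof.
move=> a0 b0; rewrite f_E // B_coef1; try by auto with mps0.
by rewrite !inv_coef1 //; ring.
Qed.

Lemma dbl2_coef0 : dbl2 0%MM = 0.
Proof. by rewrite /dbl2; auto with mps0. Qed.

Lemma dbl2_coef1 : half * dbl2 U_(ord0)%MM = 1.
Proof.
by rewrite f_coef1 // mpsX_coef1 eqxx mps0_coef addr0 mulr1 mulrC.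
Qed.

Lemma dbl2_E k (a : mps R k) : a 0%MM = 0 -> subst1 dbl2 a = subst2 dblf a 0.
Proof.
move=> a0; have pa := point1 a0.
by rewrite /subst1 subst2_comp // mpssubst0 // mpssubstX.
Qed.

Let compinv_dbl2_coef0 : compinv dbl2 0%MM = 0.
Proof. by case: (compinv_spec dbl2_coef0 dbl2_coef1). Qed.

Lemma h_coef0 k (a : mps R k) : a 0%MM = 0 -> h a 0%MM = 0.
Proof. by move=> a0; rewrite subst1_coef0. Qed.

Hint Resolve h_coef0 : mps0.

Lemma double_h k (a : mps R k) : a 0%MM = 0 -> subst2 dblf (h a) 0 = a.
Proof.
by move=> a0; rewrite -dbl2_E ?(subst1_compinv dbl2_coef0 dbl2_coef1) //;
  auto with mps0.
Qed.

Lemma h_coef1 k (a : mps R k) i : a 0%MM = 0 -> 2 * h a U_(i)%MM = a U_(i)%MM.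
Proof.
move=> a0; rewrite -[in RHS](double_h a0) f_coef1 //.
by rewrite mps0_coef addr0.
Qed.

Lemma h_inv k (a : mps R k) : a 0%MM = 0 -> h (inv a) = inv (h a).
Proof.
move=> a0; apply: (subst1_inj dbl2_coef0 dbl2_coef1); try by auto with mps0.
rewrite !dbl2_E ?double_h; try by auto with mps0.
by rewrite -{1}(double_h a0) f_inv ?inv_0 //; auto with mps0.
Qed.

Lemma h_0 k : h (0 : mps R k) = 0.
Proof. by rewrite subst1_0. Qed.

Lemma mu_E k (a b : mps R k) : a 0%MM = 0 -> b 0%MM = 0 ->
  m a b = subst2 dblf (h a) b.
Proof.
move=> a0 b0; have pab := point2 a0 b0.
rewrite -[mu]/(subst2 dblf (h x) y) subst2_subst2 //; try by auto with mps0.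
rewrite subst2X1 // [subst2 (h x) a b]subst1_comp; try by auto with mps0.
by rewrite -[mpssubst x _]/(subst2 x a b) subst2X0.
Qed.

Lemma mu_homog : mpshomog gr (- 2) mu.
Proof.
have iota_wt : mpswt gr (- 2) (- 2) iota.
  rewrite iotaE; apply: mpswtB; first exact: mpswtX.
  rewrite -[X in mpswt _ _ X]add0r; apply: mpswtM; first exact: mpswt_nat.
  by case: hT => [[_ /mpshomogE]].
have B_wt : mpswt gr (- 2) (- 2) dblB.
  rewrite -[X in mpswt _ _ X]add0r; apply: mpswtM.
    by apply: mpswtC; apply: hpart_half.
  by apply: mpswtB; [apply: dblS_wt | case: dblE_spec].
have inv_wt k (a : mps R k) : mpswt gr (- 2) (- 2) a -> mpswt gr (- 2) (- 2) (inv a).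
  exact: mpswt_subst1.
have f_wt : mpswt gr (- 2) (- 2) dblf.
  by apply: (mpswt_subst2 B_wt); apply: inv_wt; apply: mpswtX.
have dbl2_wt : mpswt gr (- 2) (- 2) dbl2.
  by apply: (mpswt_subst2 f_wt); [apply: mpswtX | apply: mpswt0].
apply/mpshomogE; apply: (mpswt_subst2 f_wt); last exact: mpswtX.
apply: mpswt_subst1 (mpswtX gr (- 2) (inord 0 : 'I_2)).
exact: (mpswt_compinv dbl2_coef0 dbl2_coef1 (hpart_half gr half2)).
Qed.

Opaque GG.

Lemma mu_coef0 k (a b : mps R k) : a 0%MM = 0 -> b 0%MM = 0 -> m a b 0%MM = 0.
Proof. by move=> a0 b0; rewrite mu_E //; auto with mps0. Qed.

Hint Resolve mu_coef0 : mps0.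

Lemma mu_coef1 k (a b : mps R k) i : a 0%MM = 0 -> b 0%MM = 0 ->
  m a b U_(i)%MM = a U_(i)%MM + b U_(i)%MM.
Proof.
by move=> a0 b0; rewrite mu_E // f_coef1 ?h_coef1 //; auto with mps0.
Qed.

Lemma mu_inv k (a b : mps R k) : a 0%MM = 0 -> b 0%MM = 0 ->
  inv (m a b) = m (inv a) (inv b).
Proof.
by move=> a0 b0; rewrite !mu_E ?f_inv ?h_inv //; auto with mps0.
Qed.

Lemma mu_0r k (a : mps R k) : a 0%MM = 0 -> m a 0 = a.
Proof. by move=> a0; rewrite mu_E // double_h. Qed.

Lemma mu_0l k (b : mps R k) : b 0%MM = 0 -> m 0 b = b.
Proof. by move=> b0; rewrite mu_E // h_0 f_0. Qed.

Lemma mu_comp k l (a b : mps R k) (g : k.-tuple (mps R l)) :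
    point g -> a 0%MM = 0 -> b 0%MM = 0 ->
  mpssubst (m a b) g = m (mpssubst a g) (mpssubst b g).
Proof. exact: subst2_comp. Qed.

(** * Quadruples with a zero argument, and commutativity *)

Lemma F3_double_h k (a b : mps R k) : a 0%MM = 0 -> b 0%MM = 0 ->
  F3 (h a) (h a) b = linprod [:: b; b; m a (inv b); inv (m a b)].
Proof.
by move=> a0 b0; rewrite F3_double ?A_f ?B_f ?mu_E //; auto with mps0.
Qed.

(** Halving makes the inner quadruple F(0, h a, h a) equal to 0, 0, a, i a. The other inner
    quadruple, F(h a, h a, b), contains b twice, so F(0, b, c) occurs twice on both sides of axiom
    (3) and cancels. *)
Lemma F3_mul_inv k (a b c : mps R k) : a 0%MM = 0 -> b 0%MM = 0 -> c 0%MM = 0 ->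
  F3 a b c * F3 (inv a) b c = F3 0 (m a (inv b)) c * F3 0 (inv (m a b)) c.
Proof.
move=> a0 b0 c0; have ha0 := h_coef0 a0.
have F0 : F3 0 (h a) (h a) = linprod [:: 0; 0; a; inv a].
  by rewrite F3C12 // F3C23 // F3_double_h // inv_0 mu_0r.
have := F3_assoc (s := [tuple 0; 0; a; inv a]) (s' := [tuple b; b; m a (inv b);
  inv (m a b)])
  (erefl : (0 : mps R k) 0%MM = 0) ha0 ha0 b0 c0.
have [ps ps'] : point [tuple 0; 0; a; inv a] /\ point [tuple b; b; m a (inv b);
  inv (m a b)].
  by split; apply: point4; auto with mps0.
move=> /(_ ps ps' F0 (F3_double_h a0 b0)); rewrite !big_cons !big_nil !mulr1.
by do 2!move=> /(poly_coef0_mulI (F3_coef0 (erefl : (0 : mps R k) 0%MM = 0) b0 c0)).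
Qed.

(** For c = 0 the two factors on the left of [F3_mul_inv] coincide and the right-hand side is a
    product of double linear factors, so a square root can be taken. *)
Lemma F3_ab0 k (a b : mps R k) : a 0%MM = 0 -> b 0%MM = 0 ->
  F3 a b 0 = linprod [:: m a (inv b); inv (m a (inv b)); inv (m a b); m a b].
Proof.
move=> a0 b0; apply: (poly_sqr_inj half2).
- by rewrite F3_coef0.
- exact: coef0_tlin_prod.
have := F3_mul_inv a0 b0 (erefl : (0 : mps R k) 0%MM = 0).
rewrite [F3 (inv a) b 0]F3C23 // F3_inv // inv_0 [F3 a 0 b]F3C23 // -expr2 => ->.
rewrite ![F3 0 _ 0]F3C12 ?F3_00 ?invK //; try by auto with mps0.
by rewrite !big_cons !big_nil !mulr1; ring.
Qed.

Lemma linprod4_root n (a b c d a' b' c' d' : mps R n) :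
    linprod [:: a; b; c; d] = linprod [:: a'; b'; c'; d'] ->
  (d - a') * ((d - b') * ((d - c') * (d - d'))) = 0.
Proof.
move=> eqL; have := @tlin_prod_root _ _ [:: a; b; c; d] [:: a'; b'; c'; d'] d erefl eqL.
rewrite !inE eqxx !orbT => /(_ isT).
by rewrite !big_cons big_nil mulr1.
Qed.

Lemma mu_comm k (a b : mps R k) : a 0%MM = 0 -> b 0%MM = 0 -> m a b = m b a.
Proof.
have univ : m x y = m y x.
  have x0 : x 0%MM = 0 by apply: mpsX_coef0.
  have y0 : y 0%MM = 0 by apply: mpsX_coef0.
  have iy0 := inv_coef0 y0; have ix0 := inv_coef0 x0.
  (* The root [m y x], with linear part x + y, is compared with the roots of F(x, y, 0). From those
     with linear parts x - y, - x + y and - x - y it differs by 2 y, 2 x and 2 x + 2 y to first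
     order, so it must be [m x y]. *)
  have := F3C12 y0 x0 (erefl : (0 : mps R 2) 0%MM = 0).
  rewrite (F3_ab0 y0 x0) (F3_ab0 x0 y0) => /linprod4_root.
  have reg (r : mps R 2) i b' : r 0%MM = 0 -> (i < 2)%N ->
      m y x U_(inord i)%MM - r U_(inord i)%MM = 2 * (- 1) ^+ b' ->
      mps_regular (m y x - r).
    move=> r0 lt_i r1; apply: (mps_reg_nat (i := inord i) (a := 1) (b := b')).
      by rewrite mps_coefD mps_coefN r0 subr0; auto with mps0.
    by rewrite mps_coefD mps_coefN r1 expr1.
  have coef1 (a' b' : mps R 2) i : a' 0%MM = 0 -> b' 0%MM = 0 -> (i < 2)%N ->
      inv (m a' b') U_(inord i)%MM = - (a' U_(inord i)%MM + b' U_(inord i)%MM).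
    by move=> a'0 b'0 lt_i; rewrite inv_coef1 ?mu_coef1 //; auto with mps0.
  have reg1 : mps_regular (m y x - m x (inv y)).
    apply: (reg _ 1%N 0%N); [exact: mu_coef0 | by [] |].
    by rewrite !mu_coef1 // inv_coef1 // !mpsX_inord_coef1 //=; ring.
  have reg2 : mps_regular (m y x - inv (m x (inv y))).
    apply: (reg _ 0%N 0%N); [exact: inv_coef0 (mu_coef0 x0 iy0) | by [] |].
    by rewrite coef1 // mu_coef1 // inv_coef1 // !mpsX_inord_coef1 //=; ring.
  have reg3 : mps_regular (m y x - inv (m x y)).
    apply: (reg _ 0%N 0%N); [exact: inv_coef0 (mu_coef0 x0 y0) | by [] |].
    by rewrite coef1 // mu_coef1 // !mpsX_inord_coef1 //=; ring.
  by move=> /reg1/reg2/reg3/eqP; rewrite subr_eq0 => /eqP.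
move=> a0 b0; have pab := point2 a0 b0.
have := congr1 (fun f => mpssubst f [tuple a; b]) univ.
by rewrite /= !mu_comp // !mpssubstX_inord.
Qed.

(** By commutativity the sum is fixed by the involution, and 0 is the only fixed point. *)
Lemma mu_invr k (a : mps R k) : a 0%MM = 0 -> m a (inv a) = 0.
Proof.
move=> a0; have ia0 := inv_coef0 a0; apply: inv_fixed; first exact: mu_coef0.
by rewrite mu_inv // invK // mu_comm.
Qed.

(** * Splitting of the general quadruple *)

Lemma mpssubst_revpoly n k d (P : {poly mps R n}) r (g : n.-tuple (mps R k)) :
  point g ->
  mpssubst (revpoly d P).[r] g = (revpoly d (tsubst P g)).[mpssubst r g].
Proof.
move=> g0; rewrite -!(substmorE g0) -horner_map /=; congr (_.[_]).
rewrite /revpoly rmorph_sum; apply: eq_bigr => i _.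
by rewrite /= map_polyZ map_polyXn rmorphM rmorph_sign coef_tsubst.
Qed.

Local Notation x3 := (mpsX R (inord 0 : 'I_3)).
Local Notation y3 := (mpsX R (inord 1 : 'I_3)).
Local Notation z3 := (mpsX R (inord 2 : 'I_3)).

Lemma subst3_coef1 k (f : mps R 3) (a b c : mps R k) i :
    a 0%MM = 0 -> b 0%MM = 0 -> c 0%MM = 0 ->
  mpssubst f [tuple a; b; c] U_(i)%MM = f U_(inord 0)%MM * a U_(i)%MM
    + f U_(inord 1)%MM * b U_(i)%MM + f U_(inord 2)%MM * c U_(i)%MM.
Proof.
move=> a0 b0 c0; rewrite mpssubst_coef1 // !big_ord_recl big_ord0 addr0 addrA.
by congr (_ * _ + _ * _ + _ * _); congr (f U_(_)%MM); apply: val_inj; rewrite /= inordK.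
Qed.

(** The automorphism adding b(x) to y and c(x) to z straightens the curve (x, b(x), c(x)) to the
    first axis, where [axis_lead_reg] applies; the opposite shift carries the conclusion back. *)
Lemma mps_regular_curve (g : mps R 3) (b c : mps R 1) d u v :
    b 0%MM = 0 -> c 0%MM = 0 ->
    axis_lead (inord 0) d u (mpssubst g [tuple x3; subst1 b x3; subst1 c x3]) ->
  v * u = 1 -> mps_regular g.
Proof.
move=> b0 c0 g_lead vu1.
pose shift (e : mps R 3) (f : mps R 3) := [tuple x3; y3 + e; z3 + f].
set bx := subst1 b x3; set cx := subst1 c x3.
have [bx0 cx0] : bx 0%MM = 0 /\ cx 0%MM = 0 by rewrite !subst1_coef0.
have shift_pt (e f : mps R 3) : e 0%MM = 0 -> f 0%MM = 0 -> point (shift e f).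
  by move=> e0 f0; apply: point3; rewrite ?mps_coefD ?e0 ?f0 ?addr0 ?mpsX_coef0.
have p1 := shift_pt _ _ bx0 cx0.
have p2 : point (shift (- bx) (- cx)).
  by apply: shift_pt; rewrite mps_coefN ?bx0 ?cx0 oppr0.
have shiftK f : mpssubst (mpssubst f (shift bx cx)) (shift (- bx) (- cx)) = f.
  rewrite mpssubst_comp // -[RHS]mpssubst_id; congr (mpssubst f _).
  apply: eq_from_tnth => i; rewrite !tnth_mktuple (tnth_nth 0).
  have bxE : mpssubst bx (shift (- bx) (- cx)) = bx by rewrite subst1_comp //
    mpssubstX_inord.
  have cxE : mpssubst cx (shift (- bx) (- cx)) = cx by rewrite subst1_comp //
    mpssubstX_inord.
  case: i => [[|[|[|]]]] //= lt_i; rewrite ?mpssubstD ?bxE ?cxE mpssubstX_inord //=;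
    rewrite ?subrK; congr mpsX; apply: val_inj; by rewrite /= inordK.
move=> w gw0; suff w0 : mpssubst w (shift bx cx) = 0 by rewrite -[w]shiftK w0 mpssubst0.
have gw0' : mpssubst g (shift bx cx) * mpssubst w (shift bx cx) = 0.
  by rewrite -mpssubstM // gw0 mpssubst0.
apply: (axis_lead_reg (i := inord 0) (d := d) (c := u) _ vu1 gw0').
have eq_g j : mpssubst g (shift bx cx) (U_(inord 0) *+ j)%MM =
    mpssubst g [tuple x3; bx; cx] (U_(inord 0) *+ j)%MM.
  (* Setting the last two variables to 0 after the shift restricts [g] to the curve and keeps
     exactly the coefficients along the first axis. *)
  pose Z := restr_tuple R (pred1 (inord 0 : 'I_3)); have pZ : point Z :=
    point_restr _ _.
  have -> : mpssubst g [tuple x3; bx; cx] = mpssubst (mpssubst g (shift bx cx)) Z.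
    have xZ : mpssubst x3 Z = x3 by rewrite mpssubstX // tnth_mktuple /= eqxx.
    have bZ : mpssubst bx Z = bx by rewrite subst1_comp // xZ.
    have cZ : mpssubst cx Z = cx by rewrite subst1_comp // xZ.
    rewrite mpssubst_comp //; congr (mpssubst g _); apply: eq_from_tnth => i.
    rewrite tnth_mktuple !(tnth_nth 0); case: i => [[|[|[|]]]] //= lt_i.
      by rewrite mpssubstD bZ mpssubstX // tnth_mktuple /= -val_eqE /= !inordK // add0r.
    by rewrite mpssubstD cZ mpssubstX // tnth_mktuple /= -val_eqE /= !inordK // add0r.
  rewrite mpssubst_restr; case: forallP => // -[] i; apply/implyP.
  by rewrite mulmnE mnm1E [inord 0 == i]eq_sym /=; case: (i == _).
by split=> [j lt_j|]; rewrite eq_g; [apply: g_lead.1 | apply: g_lead.2].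
Qed.

Lemma revpoly_linprod4_lead n (i : 'I_n) (r a b c d : mps R n) :
    r 0%MM = 0 -> a 0%MM = 0 -> b 0%MM = 0 -> c 0%MM = 0 -> d 0%MM = 0 ->
  axis_lead i 4 ((r U_(i)%MM - a U_(i)%MM) * ((r U_(i)%MM - b U_(i)%MM) *
      ((r U_(i)%MM - c U_(i)%MM) * (r U_(i)%MM - d U_(i)%MM))))
    (revpoly 4 (linprod [:: a; b; c; d])).[r].
Proof.
move=> r0 a0 b0 c0 d0; rewrite (revpoly_tlin_prod [:: a; b; c; d]).
rewrite !big_cons big_nil mulr1 !hornerM !hornerXsubC.
have lead (e : mps R n) : e 0%MM = 0 -> axis_lead i 1 (r U_(i)%MM - e U_(i)%MM) (r - e).
  move=> e0; have := @axis_lead1 R n i (r - e); rewrite !mps_coefD !mps_coefN.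
  by apply; rewrite r0 e0 subr0.
by do 3!(apply: (@axis_leadM _ _ _ 1); first exact: lead); apply: lead.
Qed.

(** On both curves used next, - 16 is the product of the four differences of linear coefficients: 2,
    2, - 2, 2 on the first and - 2, - 2, - 2, 2 on the second. *)
Let half16 : - half ^+ 4 * - 16 = 1 :> R.
Proof. by transitivity ((2 * half) ^+ 4); [ring | rewrite half2 expr1n]. Qed.

(* On the curves (t, t, t) and (t, t, inv t) the quadruple of (inv x, y, z)
   splits by axiom (5). *)
Lemma F3_inv_root_regular (r : mps R 3) : r 0%MM = 0 ->
    r U_(inord 0)%MM + r U_(inord 1)%MM + r U_(inord 2)%MM = 1 \/
    r U_(inord 0)%MM + r U_(inord 1)%MM - r U_(inord 2)%MM = - 1 ->
  mps_regular (revpoly 4 (F3 (inv x3) y3 z3)).[r].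
Proof.
have x0 : x3 0%MM = 0 by apply: mpsX_coef0.
have ix0 := inv_coef0 x0.
have x1 : x3 U_(inord 0)%MM = 1 by rewrite mpsX_inord_coef1.
have pX : mpsX R (ord0 : 'I_1) 0%MM = 0 by apply: mpsX_coef0.
move=> r0 [] r1.
- apply: (mps_regular_curve (b := mpsX R ord0) (c := mpsX R ord0) (d :=
  4) _ _ _ half16) => //.
  rewrite subst1X // mpssubst_revpoly // F3_comp // subst1_inv // !mpssubstX_inord //=.
  rewrite F3C12 // F3C23 // F3_double //.
  set r' := mpssubst _ _; have r'0 : r' 0%MM = 0 by rewrite mpssubst_coef0.
  have r'1 : r' U_(inord 0)%MM = 1 by rewrite subst3_coef1 // x1 !mulr1.
  have := revpoly_linprod4_lead (inord 0) r'0 ix0 ix0 (A_coef0 x0 ix0) (B_coef0 x0 ix0).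
  rewrite r'1 A_coef1 // B_coef1 // inv_coef1 // x1; congr (axis_lead _ _ _ _); ring.
- apply: (mps_regular_curve (b := mpsX R ord0) (c := iota) (d := 4) _ _ _ half16) => //.
  rewrite subst1X // mpssubst_revpoly // F3_comp // subst1_inv // !mpssubstX_inord //=.
  rewrite F3C23 // F3_inv // invK // F3_double //.
  set r' := mpssubst _ _; have r'0 : r' 0%MM = 0 by rewrite mpssubst_coef0.
  have r'1 : r' U_(inord 0)%MM = - 1.
    by rewrite subst3_coef1 // inv_coef1 // x1 !mulr1 mulrN1.
  have := revpoly_linprod4_lead (inord 0) r'0 x0 x0 (A_coef0 x0 x0) (B_coef0 x0 x0).
  rewrite r'1 A_coef1 // B_coef1 // x1; congr (axis_lead _ _ _ _); ring.
Qed.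
Lemma F3_0M k (M c : mps R k) : M 0%MM = 0 -> c 0%MM = 0 ->
  F3 0 M c = linprod [:: m M (inv c); inv (m M (inv c)); inv (m M c); m M c] /\
  F3 0 (inv M) c = F3 0 M c.
Proof.
move=> M0 c0; rewrite -(F3_ab0 M0 c0); split.
  by rewrite F3C12 // F3C23.
by rewrite F3C12 // F3_inv // inv_0 F3C12.
Qed.

Lemma F3_roots k (a b c : mps R k) : a 0%MM = 0 -> b 0%MM = 0 -> c 0%MM = 0 ->
  F3 a b c = linprod [:: m (m a b) (inv c); m (m a (inv b)) c;
                         inv (m (m a (inv b)) (inv c)); inv (m (m a b) c)].
Proof.
have univ : F3 x3 y3 z3 = linprod [:: m (m x3 y3) (inv z3); m (m x3 (inv y3)) z3;
    inv (m (m x3 (inv y3)) (inv z3)); inv (m (m x3 y3) z3)].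
  have x0 : x3 0%MM = 0 by apply: mpsX_coef0.
  have y0 : y3 0%MM = 0 by apply: mpsX_coef0.
  have z0 : z3 0%MM = 0 by apply: mpsX_coef0.
  have ix0 := inv_coef0 x0; have iy0 := inv_coef0 y0; have iz0 := inv_coef0 z0.
  set M := m x3 (inv y3); set N := m x3 y3.
  have M0 : M 0%MM = 0 by apply: mu_coef0.
  have N0 : N 0%MM = 0 by apply: mu_coef0.
  have M1 i : M U_(i)%MM = x3 U_(i)%MM - y3 U_(i)%MM by rewrite mu_coef1 // inv_coef1.
  have N1 i : N U_(i)%MM = x3 U_(i)%MM + y3 U_(i)%MM by rewrite mu_coef1.
  have := F3_mul_inv x0 y0 z0; rewrite -/M -/N.
  have [-> _] := F3_0M M0 z0; have [E ->] := F3_0M N0 z0; rewrite {}E -big_cat.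
  set l := _ ++ _ => prodE; clearbody M N.
  (* The product of the monic polynomials of F(x, y, z) and F(i x, y, z) vanishes at each of the
     eight roots; cancelling the value of the second leaves that of the first. *)
  have root_l r : r \in l -> mps_regular (revpoly 4 (F3 (inv x3) y3 z3)).[r] ->
      (revpoly 4 (F3 x3 y3 z3)).[r] = 0.
    move=> l_r r_reg; apply: r_reg; rewrite mulrC -hornerM.
    rewrite -(revpolyM (d := 4) (e := 4)) ?size_F3 // prodE (revpoly_tlin_prod l).
    by rewrite (big_rem r) //= hornerM hornerXsubC subrr mul0r.
  set r1 := m N (inv z3) in l root_l prodE *; set r2 := m M z3 in l root_l prodE *.
  set r3 := inv (m M (inv z3)) in l root_l prodE *.
  set r4 := inv (m N z3) in l root_l prodE *.
  pose e (i : nat) : R := (i == 0)%:R; pose e' (i : nat) : R := (i == 1)%:R.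
  pose e'' (i : nat) : R := (i == 2)%:R.
  have coefs (i : nat) : (i < 3)%N -> [/\ x3 U_(inord i)%MM = e i, y3 U_(inord i)%MM
    = e' i
      & z3 U_(inord i)%MM = e'' i].
    by move=> lt_i; split; rewrite mpsX_inord_coef1 // eq_sym.
  have r1E i : (i < 3)%N -> r1 U_(inord i)%MM = e i + e' i - e'' i.
    move=> /coefs[xi yi zi]; rewrite mu_coef1 // N1 inv_coef1 // xi yi zi; ring.
  have r2E i : (i < 3)%N -> r2 U_(inord i)%MM = e i - e' i + e'' i.
    move=> /coefs[xi yi zi]; rewrite mu_coef1 // M1 xi yi zi; ring.
  have r3E i : (i < 3)%N -> r3 U_(inord i)%MM = - e i + e' i + e'' i.
    move=> /coefs[xi yi zi]; rewrite inv_coef1 ?mu_coef0 // mu_coef1 //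
      M1 inv_coef1 // xi yi zi; ring.
  have r4E i : (i < 3)%N -> r4 U_(inord i)%MM = - e i - e' i - e'' i.
    move=> /coefs[xi yi zi]; rewrite inv_coef1 ?mu_coef0 // mu_coef1 // N1 xi yi zi;
      ring.
  have [r10 r20 r30 r40] : [/\ r1 0%MM = 0, r2 0%MM = 0, r3 0%MM = 0 & r4 0%MM = 0].
    split; [exact: mu_coef0 N0 iz0 | exact: mu_coef0 M0 z0 |
      exact: inv_coef0 (mu_coef0 M0 iz0) | exact: inv_coef0 (mu_coef0 N0 z0)].
  have [l1 l2 l3 l4] : [/\ r1 \in l, r2 \in l, r3 \in l & r4 \in l].
    clearbody r1 r2 r3 r4.
    by split; rewrite /l mem_cat !inE eqxx ?orbT.
  clearbody r1 r2 r3 r4 l.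
  (* For any two of the four roots kept, some variable has coefficient 1 in the earlier one and - 1
     in the later one; the index passed in each case below is such a variable. *)
  have diff_reg (r r' : mps R 3) i : r 0%MM = 0 -> r' 0%MM = 0 -> (i < 3)%N ->
      r' U_(inord i)%MM - r U_(inord i)%MM = - 2 -> mps_regular (r' - r).
    move=> r0 r'0 lt_i rr'; apply: (mps_reg_nat (i := inord i) (a := 1) (b := 1)).
      by rewrite mps_coefD mps_coefN r0 r'0 subr0.
    by rewrite mps_coefD mps_coefN rr' !expr1 mulrN1.
  apply: (@eq_tlin_prod _ _ [:: r1; r2; r3; r4]); first exact: F3_coef0.
  - exact: size_F3.
  - split; [|split; [|split; [|by []]]] => r; rewrite !inE.
    + move=> /or3P[] /eqP ->.
      * by apply: (diff_reg _ _ 1%N); rewrite // r1E // r2E // /e /e' /e'' /=; ring.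
      * by apply: (diff_reg _ _ 0%N); rewrite // r1E // r3E // /e /e' /e'' /=; ring.
      * by apply: (diff_reg _ _ 0%N); rewrite // r1E // r4E // /e /e' /e'' /=; ring.
    + move=> /orP[] /eqP ->.
      * by apply: (diff_reg _ _ 0%N); rewrite // r2E // r3E // /e /e' /e'' /=; ring.
      * by apply: (diff_reg _ _ 0%N); rewrite // r2E // r4E // /e /e' /e'' /=; ring.
    + by move=> ->; apply: (diff_reg _ _ 1%N); rewrite // r3E // r4E //
      /e /e' /e'' /=; ring.
  (* The first three linear parts sum to 1 on (t, t, t). The fourth gives - 3 there, so the curve
     (t, t, i t) is used, on which it gives - 1. *)
  - move=> r; rewrite !inE => /or4P[] /eqP ->; apply: root_l => //;
      apply: F3_inv_root_regular => //.
    + by left; rewrite !r1E // /e /e' /e'' /=; ring.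
    + by left; rewrite !r2E // /e /e' /e'' /=; ring.
    + by left; rewrite !r3E // /e /e' /e'' /=; ring.
    + by right; rewrite !r4E // /e /e' /e'' /=; ring.
move=> a0 b0 c0; have pabc := point3 a0 b0 c0.
have := congr1 (fun G => tsubst G [tuple a; b; c]) univ.
rewrite /= F3_comp // !mpssubstX_inord //= => ->.
rewrite tsubst_prod // !big_cons !big_nil !tsubst_tlin //.
by rewrite !(mu_comp, subst1_inv) ?mpssubstX_inord //=; auto 8 with mps0.
Qed.

(** * Associativity, and recovery of the ternary law *)

Lemma mu_assoc k (a b c : mps R k) : a 0%MM = 0 -> b 0%MM = 0 -> c 0%MM = 0 ->
  m (m a b) c = m a (m b c).
Proof.
(* This is the form that the exchange of x and z in F(x, y, z) provides; commutativity turns it into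
   associativity. *)
have univ : m (m x3 y3) z3 = m (m z3 y3) x3.
  have x0 : x3 0%MM = 0 by apply: mpsX_coef0.
  have y0 : y3 0%MM = 0 by apply: mpsX_coef0.
  have z0 : z3 0%MM = 0 by apply: mpsX_coef0.
  have ix0 := inv_coef0 x0; have iy0 := inv_coef0 y0.
  have xy0 := mu_coef0 x0 y0; have zy0 := mu_coef0 z0 y0; have ziy0 := mu_coef0 z0 iy0.
  have eqF : F3 x3 y3 z3 = F3 z3 y3 x3.
    exact: etrans (F3C23 x0 y0 z0) (etrans (F3C12 x0 z0 y0) (F3C23 z0 x0 y0)).
  move: eqF; rewrite (F3_roots x0 y0 z0) (F3_roots z0 y0 x0) => /linprod4_root.
  (* All linear coefficients of [d] are - 1, whereas three of the roots of F(z, y, x) have a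
     coefficient 1 in some variable, so [d] must be the fourth. *)
  set d := inv (m (m x3 y3) z3).
  have d0 : d 0%MM = 0 := inv_coef0 (mu_coef0 xy0 z0).
  have d1 i : (i < 3)%N -> d U_(inord i)%MM = - 1.
    move=> lt_i; rewrite inv_coef1 ?mu_coef0 // !mu_coef1 // !mpsX_inord_coef1 //.
    by case: i lt_i => [|[|[|]]] //= _; ring.
  have reg (r : mps R 3) i : r 0%MM = 0 -> (i < 3)%N -> r U_(inord i)%MM = 1 ->
      mps_regular (d - r).
    move=> r0 lt_i r1; apply: (mps_reg_nat (i := inord i) (a := 1) (b := 1)).
      by rewrite mps_coefD mps_coefN r0 d0 subr0.
    by rewrite mps_coefD mps_coefN r1 d1 // !expr1 mulrN1 -opprD.
  have reg1 : mps_regular (d - m (m z3 y3) (inv x3)).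
    apply: (reg _ 1%N (mu_coef0 zy0 ix0) isT).
    by rewrite !mu_coef1 // inv_coef1 // !mpsX_inord_coef1 //=; ring.
  have reg2 : mps_regular (d - m (m z3 (inv y3)) x3).
    apply: (reg _ 0%N (mu_coef0 ziy0 x0) isT).
    by rewrite !mu_coef1 // inv_coef1 // !mpsX_inord_coef1 //=; ring.
  have reg3 : mps_regular (d - inv (m (m z3 (inv y3)) (inv x3))).
    apply: (reg _ 0%N (inv_coef0 (mu_coef0 ziy0 ix0)) isT).
    by rewrite inv_coef1 ?mu_coef0 // !mu_coef1 // !inv_coef1 //
      !mpsX_inord_coef1 //=; ring.
  move=> /reg1/reg2/reg3/eqP; rewrite subr_eq0 => /eqP.
  exact: inv_inj (mu_coef0 xy0 z0) (mu_coef0 zy0 x0).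
move=> a0 b0 c0; have pabc := point3 a0 b0 c0.
have := congr1 (fun f => mpssubst f [tuple a; b; c]) univ.
rewrite /= !mu_comp ?mpssubstX_inord //=; try by auto with mps0.
by move=> ->; rewrite [m c b]mu_comm // mu_comm //; auto with mps0.
Qed.

Lemma GG_is_FGL : is_FGL gr mu.
Proof.
have X0 n (i : 'I_n) := mpsX_coef0 R i.
split; first exact: mu_homog.
- exact: mu_0r.
- exact: mu_comm.
- exact: mu_assoc.
Qed.

(** Whichever inverse [j] was chosen, j = (i t + t) + j = i t + (t + j) = i t for the addition
    [mu]. *)
Lemma FGLinv_GG : FGLinv mu = iota.
Proof.
have t0 := mpsX_coef0 R (ord0 : 'I_1).
have iotaX : inv (mpsX R (ord0 : 'I_1)) = iota.
  rewrite /subst1 -[RHS]mpssubst_id; congr (mpssubst _ _).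
  by apply: eq_from_tnth => i; rewrite tnth_mktuple [i]ord1.
rewrite /FGLinv; case: xgetP => [j _ [j0 mj]|/(_ iota)[]]; last first.
  by split=> //; rewrite -[in m _ iota]iotaX mu_invr.
have it0 := inv_coef0 t0.
rewrite -[j]mu_0l // -(mu_invr t0) [m _ (inv _)]mu_comm // mu_assoc // mj.
by rewrite mu_0r // iotaX.
Qed.

Lemma prod_odd_signs (A : comNzRingType) (G : bool * bool * bool -> A) :
  \prod_(e : bool * bool * bool | e.1.1 (+) e.1.2 (+) e.2) G e =
  G (true, true, true) * G (true, false, false) * G (false, true, false)
    * G (false, false, true).
Proof.
pose H e1 e2 e3 := if e1 (+) e2 (+) e3 then G (e1, e2, e3) else 1.
rewrite big_mkcond /=.
transitivity (\prod_(e : bool * bool * bool) H e.1.1 e.1.2 e.2).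
  by apply: eq_bigr => -[[e1 e2] e3].
rewrite -(pair_bigA _ (fun u : bool * bool => H u.1 u.2)) /=.
rewrite -(pair_bigA _ (fun e1 e2 => \prod_e3 H e1 e2 e3)) /=.
by rewrite !big_bool /H /= !(mul1r, mulr1) !mulrA.
Qed.

Lemma TT_GG : TT half mu = T.
Proof.
have [x0 y0 z0] : [/\ x3 0%MM = 0, y3 0%MM = 0 & z3 0%MM = 0] by rewrite !mpsX_coef0.
have [ix0 iy0 iz0] := And3 (inv_coef0 x0) (inv_coef0 y0) (inv_coef0 z0).
have PsiE : mpsC 1 half * (mpsX R ord0 - iota) = Psi.
  rewrite iotaE; transitivity (2 * mpsC 1 half * Psi); first by ring.
  by rewrite half2C mul1r.
have FE : F = linprod [:: m (m x3 y3) (inv z3); m (m x3 (inv y3)) z3;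
    m (m (inv x3) y3) z3; m (m (inv x3) (inv y3)) (inv z3)].
  (* [F3_roots] has the involution outside the last two roots; distributing it over [mu] produces
     the sign patterns in the definition of [TT]. *)
  have r3 := mu_inv (mu_coef0 x0 iy0) iz0; have r4 := mu_inv (mu_coef0 x0 y0) z0.
  rewrite (mu_inv x0 iy0) !invK // in r3; rewrite (mu_inv x0 y0) in r4.
  by rewrite -r3 -r4 -[LHS]tsubst3_id; apply: F3_roots.
transitivity (Ternary iota Psi F); last by case: (T).
rewrite /TT FGLinv_GG PsiE; congr Ternary.
rewrite prod_odd_signs /FGLsign FGLinv_GG FE !big_cons big_nil mulr1.
set a := tlin _; set b := tlin _; set c := tlin _; set d := tlin _.
by rewrite !mulrA; ring.
Qed.
End TernaryLaw.

Theorem proposition8p4p8 (R : comNzRingType) (gr : grading R)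
    (half : R) (half2 : 2 * half = 1) (T : ternary R) (hT : is_FTL gr T) :
  is_FGL gr (GG half T) /\ TT half (GG half T) = T.
Proof. by split; [exact: (GG_is_FGL half2 hT) | exact: (TT_GG half2 hT)]. Qed.
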